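(* Given a tree $T$, Algorithm 1 (written out in full in the context) determines a gt-set of $T$ in linear time.
   Context: A geodesic in a graph $G$ is a shortest path between two vertices; a geodesic is maximal if it is not a subpath of a longer geodesic. A geodesic-transversal set of $G$ is a set $S\subseteq V(G)$ such that every maximal geodesic of $G$ contains at least one vertex of $S$. A gt-set of $G$ is a geodesic-transversal set of $G$ of minimum cardinality. A leaf of a tree is a vertex of degree $1$; a neighbor of a leaf is a support vertex; a support vertex $u$ is an end support vertex if $u$ is adjacent to at least $\deg(u)-1$ leaves. If $u$ is a vertex of degree $2$ in $G$ with neighbors $x$ and $y$, then smoothing $u$ means removing $u$ and adding the edge $xy$. $\mathrm{SM}(G)$ denotes the graph obtained from $G$ by smoothing all vertices of $G$ of degree $2$ (it is unique up to isomorphism). Algorithm 1 (a gt-set of a tree). Input: a tree $T$. Output: a gt-set $S$ of $T$. 1. Set $S=\emptyset$. 2. Set $T=\mathrm{SM}(T)$ (i.e., perform the smoothing operation on each vertex of degree $2$ in $T$). 3. While $|V(T)|>0$, do the following steps 4-7: 4. identify an arbitrary end support vertex $p$ of $\mathrm{SM}(T)$; 5. set $S=S\cup\{p\}$; 6. set $T=T\setminus\{p,p_1,\ldots,p_t\}$, where $p_1,\ldots,p_t$ are the leaf neighbors of $p$; 7. set $T=\mathrm{SM}(T)$.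
   Formalization: The tree T is assumed to have at least two vertices: the one-vertex tree has no leaf, hence no end support vertex, so step 4 of Algorithm 1 cannot be carried out there and no gt-set is returned. *)

(* Defs.v *)
(** Geodesic-transversal sets of trees, the greedy smoothing algorithm that
    computes them, and the random access machine on which its running time is
    measured. MathComp. *)
From mathcomp Require Import all_boot.
Set Implicit Arguments.
Unset Strict Implicit.
Unset Printing Implicit Defensive.

(** * Finite simple graphs *)

(** The vertex set is a subset of an ambient finite type, so that vertex
    deletion and smoothing stay within the type [graph V]. *)
Record graph (V : finType) := Graph {
  verts : {set V};
  adj : rel V;
  adj_sym : symmetric adj;
  adj_irr : irreflexive adj;
  adj_verts : forall x y, adj x y -> x \in verts
}.

Section Graphs.
Variable V : finType.
Implicit Types (g : graph V) (u v w x y p : V) (s q : seq V) (S A : {set V}).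

Definition is_tree g : Prop :=
  [/\ verts g != set0,
      {in verts g &, forall x y, connect (adj g) x y} &
      forall c, cycle (adj g) c -> uniq c -> size c <= 2].

(** ** Geodesics *)

(** The path [x :: q] is given by its first vertex and the rest of it. *)
Definition is_path g x q : bool :=
  [&& x \in verts g, path (adj g) x q & uniq (x :: q)].

Definition geodesic_from g x q : Prop :=
  is_path g x q /\
  forall q', is_path g x q' -> last x q' = last x q -> size q <= size q'.

Definition geodesic g s : Prop :=
  if s is x :: q then geodesic_from g x q else False.

(** Both orientations of a geodesic are geodesics, so [infix] is enough to
    express that one is a subpath of another. *)
Definition maximal_geodesic g s : Prop :=
  geodesic g s /\
  ~ exists s', [/\ geodesic g s', infix s s' & size s < size s'].

Definition gt_transversal g S : Prop :=
  S \subset verts g /\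
  forall s, maximal_geodesic g s -> exists2 x, x \in s & x \in S.

Definition gt_set g S : Prop :=
  gt_transversal g S /\ forall S', gt_transversal g S' -> #|S| <= #|S'|.

(** ** Leaves and support vertices *)

Definition nbrs g v : {set V} := [set w | adj g v w].
Definition deg g v : nat := #|nbrs g v|.
Definition leaf g v : bool := deg g v == 1.
Definition leaf_nbrs g v : {set V} := [set w in nbrs g v | leaf g w].
Definition support g v : bool := leaf_nbrs g v != set0.
Definition end_support g v : bool :=
  support g v && ((deg g v).-1 <= #|leaf_nbrs g v|).

(** ** Deletion and smoothing *)

Definition delete_adj g A : rel V :=
  fun x y => [&& x \notin A, y \notin A & adj g x y].

Lemma delete_sym g A : symmetric (delete_adj g A).
Proof. by move=> x y; rewrite /delete_adj adj_sym andbCA. Qed.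

Lemma delete_irr g A : irreflexive (delete_adj g A).
Proof. by move=> x; rewrite /delete_adj adj_irr !andbF. Qed.

Lemma delete_verts g A x y : delete_adj g A x y -> x \in verts g :\: A.
Proof. by case/and3P=> xA _ /adj_verts xg; rewrite inE xA. Qed.

Definition delete g A : graph V :=
  Graph (@delete_sym g A) (@delete_irr g A) (@delete_verts g A).

(** For [u] of degree 2 with neighbors [x] and [y], the edge added is [xy]. *)
Definition smooth_adj g u : rel V :=
  fun x y => [&& x != u, y != u &
                 adj g x y || [&& x != y, adj g u x & adj g u y]].

Lemma smooth_sym g u : symmetric (smooth_adj g u).
Proof.
move=> x y; rewrite /smooth_adj adj_sym andbCA [x == y]eq_sym.
by rewrite [adj g u x && _]andbC.
Qed.

Lemma smooth_irr g u : irreflexive (smooth_adj g u).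
Proof. by move=> x; rewrite /smooth_adj adj_irr eqxx !andbF. Qed.

Lemma smooth_verts g u x y : smooth_adj g u x y -> x \in verts g :\ u.
Proof.
case/and3P=> xu _ /orP[/adj_verts|/and3P[_]]; first by rewrite !inE xu.
by rewrite adj_sym => /adj_verts xg _; rewrite !inE xu.
Qed.

Definition smooth g u : graph V :=
  Graph (@smooth_sym g u) (@smooth_irr g u) (@smooth_verts g u).

(** In a tree, smoothing a vertex of degree 2 does not change the degrees of
    the others, so each of the listed vertices still has degree 2 at its turn,
    and none of degree 2 is left. *)
Definition SM g : graph V :=
  foldl smooth g (enum [set u in verts g | deg g u == 2]).

(** ** The algorithm *)

(** The values of the variables [S] and [T]. *)
Definition config := ({set V} * graph V)%type.

Definition alg_init g : config := (set0, SM g).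

Definition alg_choice (c : config) p : bool :=
  (0 < #|verts c.2|) && end_support (SM c.2) p.

Definition alg_iter (c : config) p : config :=
  (p |: c.1, SM (delete c.2 (p |: leaf_nbrs c.2 p))).

Fixpoint alg_choices (c : config) s : bool :=
  if s is p :: s' then alg_choice c p && alg_choices (alg_iter c p) s' else true.

(** The choice of [p] is arbitrary; a run is determined by the sequence of the
    vertices chosen in its successive iterations. *)
Definition alg_run g s : bool := alg_choices (alg_init g) s.
Definition alg_state g s : config := foldl alg_iter (alg_init g) s.
Definition alg_halted g s : bool := #|verts (alg_state g s).2| == 0.

End Graphs.

(** * A random access machine *)

(** Registers and memory cells hold numbers below a word bound [W]; an
    instruction whose result would not fit has no execution. Programs are
    finite and cannot mention the input size. *)
Inductive cmd :=
  | Const of nat & nat            (* r := k *)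
  | Add of nat & nat & nat        (* r := a + b *)
  | Sub of nat & nat & nat        (* r := a - b, truncated at 0 *)
  | Read of nat & nat             (* r := mem[a] *)
  | Write of nat & nat            (* mem[a] := b *)
  | Seq of cmd & cmd
  | IfLt of nat & nat & cmd & cmd (* if a < b then _ else _ *)
  | WhileLt of nat & nat & cmd.   (* while a < b do _ *)

Record state := State { regs : nat -> nat; mem : nat -> nat }.

Definition set_reg (s : state) (r v : nat) : state :=
  State [eta regs s with r |-> v] (mem s).
Definition set_mem (s : state) (a v : nat) : state :=
  State (regs s) [eta mem s with a |-> v].

(** [exec W c s t s']: started in [s], [c] halts in [s'] after [t] steps.
    Every instruction and every test is one step. *)
Inductive exec (W : nat) : cmd -> state -> nat -> state -> Prop :=
  | ExecConst r k s : k < W -> exec W (Const r k) s 1 (set_reg s r k)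
  | ExecAdd r a b s : regs s a + regs s b < W ->
      exec W (Add r a b) s 1 (set_reg s r (regs s a + regs s b))
  | ExecSub r a b s : regs s a - regs s b < W ->
      exec W (Sub r a b) s 1 (set_reg s r (regs s a - regs s b))
  | ExecRead r a s : regs s a < W -> mem s (regs s a) < W ->
      exec W (Read r a) s 1 (set_reg s r (mem s (regs s a)))
  | ExecWrite a b s : regs s a < W -> regs s b < W ->
      exec W (Write a b) s 1 (set_mem s (regs s a) (regs s b))
  | ExecSeq c1 c2 s1 s2 s3 t1 t2 :
      exec W c1 s1 t1 s2 -> exec W c2 s2 t2 s3 ->
      exec W (Seq c1 c2) s1 (t1 + t2) s3
  | ExecIfTrue a b c1 c2 s t s' : regs s a < regs s b ->
      exec W c1 s t s' -> exec W (IfLt a b c1 c2) s t.+1 s'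
  | ExecIfFalse a b c1 c2 s t s' : regs s b <= regs s a ->
      exec W c2 s t s' -> exec W (IfLt a b c1 c2) s t.+1 s'
  | ExecWhileStop a b c s : regs s b <= regs s a ->
      exec W (WhileLt a b c) s 1 s
  | ExecWhileLoop a b c s1 s2 s3 t1 t2 : regs s1 a < regs s1 b ->
      exec W c s1 t1 s2 -> exec W (WhileLt a b c) s2 t2 s3 ->
      exec W (WhileLt a b c) s1 (t1 + t2).+1 s3.

(** ** Input and output *)

Definition adj_lists (n : nat) (g : graph 'I_n) (L : 'I_n -> seq 'I_n) : Prop :=
  forall v, uniq (L v) /\ forall w, (w \in L v) = adj g v w.

(** Cell 0 holds [n]; cell [v.+1], for [v <= n], holds the address at which the
    adjacency list of [v] starts (and that of [v.-1] ends); the concatenation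
    of the lists is stored from address [n.+2] on. *)
Definition encode (n : nat) (L : 'I_n -> seq 'I_n) : seq nat :=
  let ls := [seq [seq val w | w <- L v] | v <- enum 'I_n] in
  n :: [seq n.+2 + sumn (take v (shape ls)) | v <- iota 0 n.+1] ++ flatten ls.

Definition input_state (n : nat) (L : 'I_n -> seq 'I_n) : state :=
  State (fun _ => 0) (nth 0 (encode L)).

(** Register 0 points to the output sequence and register 1 is its length. *)
Definition output (s : state) : seq nat :=
  [seq mem s (regs s 0 + i) | i <- iota 0 (regs s 1)].

(* Main.v *)
(** In a tree with an edge the maximal geodesics are the paths between leaves, so
    a set is geodesic-transversal exactly when its removal separates the leaves
    from each other. Smoothing neither changes the leaves nor, up to trading a
    smoothed vertex for a neighbor, the separating sets. When a tree has no vertex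
    of degree 2, every separating set meets the star formed by an end support
    vertex [p] and its leaf neighbors, while [p] alone cuts these leaves off;
    hence an iteration lowers the minimum by exactly 1, whichever [p] is chosen.

    For the linear bound, root the tree at a leaf and treat children before their
    parents (reverse breadth-first order). A vertex is chosen when at least two
    leaves still survive below it, and then these leaves are dropped; as at most
    one survives below each child, one counter per vertex is enough. That this
    is a run of the algorithm is shown without describing the smoothed trees:
    all that matters is that the current tree separates its own leaves as the
    initial one does. Rooting at a leaf ensures that a chosen vertex below the
    root separates three surviving leaves, so that it was not smoothed away. *)
Require Import Defs.
From mathcomp Require Import all_boot zify.
Set Implicit Arguments.
Unset Strict Implicit.
Unset Printing Implicit Defensive.

(** Since the graph changes at every iteration, everything is expressed by one relation that
    survives the changes: connectivity after deletion of a set of vertices ([delete_adj]). Between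
    remaining vertices it is unaffected by the removal of an end support vertex with its leaves, and
    by smoothing a vertex outside the deleted set ([connect_delete], [connect_smooth]). Acyclicity,
    branches and separation of leaves are all stated through it.

    Why a vertex [v] with two surviving leaves below it is an end support vertex of the current
    tree: each branch at [v] away from the root contains a single leaf, and without vertices of
    degree 2 such a branch is that leaf alone, so all neighbors of [v] but one are leaves. Why [v]
    is still present: a smoothed vertex has only two branches to hold the leaves, and next to a
    removed star all surviving leaves lie on one side, so no vertex that is gone separates three
    surviving leaves. *)

Lemma connect_ind (T : finType) (e : rel T) (P : T -> Prop) x y :
  P x -> (forall a b, connect e x a -> e a b -> P a -> P b) ->
  connect e x y -> P y.
Proof.
move=> Px Pe /connectP[q eq_q ->]; elim/last_ind: q eq_q => [//|q z IHq].
rewrite rcons_path last_rcons => /andP[eq_q ez].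
by apply: Pe ez (IHq eq_q); apply/connectP; exists q.
Qed.

(** * Trees *)

Section Graphs.
Variable V : finType.
Implicit Types (g : graph V) (u v w x y z p : V) (S A : {set V}).

Definition branch g u v : {set V} := [set x | connect (delete_adj g [set u]) v x].

(** Acyclicity, as the uniqueness of the neighbor of [v] in each component of
    [g] without [v]. *)
Definition forest g : Prop := forall v w w',
  adj g v w -> adj g v w' -> connect (delete_adj g [set v]) w w' -> w = w'.

Definition connected g : Prop := {in verts g &, forall x y, connect (adj g) x y}.

(** Unlike the cycle condition of [is_tree], these properties transfer directly along smoothing. A
    single vertex is excluded, so that every vertex has a neighbor and there are two leaves. *)
Record tree g : Prop := Tree {
  tree_connected : connected g;
  tree_forest : forest g;
  tree_verts : 1 < #|verts g| }.

Lemma adj_vertsr g x y : adj g x y -> y \in verts g.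
Proof. by rewrite adj_sym => /adj_verts. Qed.

Lemma adj_neq g x y : adj g x y -> x != y.
Proof. by apply: contraTneq => ->; rewrite adj_irr. Qed.

Lemma connect_delC g S x y :
  connect (delete_adj g S) x y = connect (delete_adj g S) y x.
Proof. exact: (sym_connect_sym (@delete_sym V g S)). Qed.

Lemma connect_delS g S S' x y : S \subset S' ->
  connect (delete_adj g S') x y -> connect (delete_adj g S) x y.
Proof.
move=> /subsetP sSS'; apply: connect_sub => a b /and3P[aS bS ab].
by apply: connect1; rewrite /delete_adj ab (contra (sSS' a)) // (contra (sSS' b)).
Qed.

Lemma connect_del0 g x y : connect (delete_adj g set0) x y = connect (adj g) x y.
Proof. by apply: eq_connect => a b; rewrite /delete_adj !inE. Qed.

Lemma connect_del g S x y : connect (delete_adj g S) x y -> connect (adj g) x y.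
Proof. by move=> /(connect_delS (sub0set S)); rewrite connect_del0. Qed.

Lemma connect_del_notin g S x y : connect (delete_adj g S) x y -> x != y -> y \notin S.
Proof.
move=> c; have: x = y \/ y \notin S.
  apply: (connect_ind (P := fun y => x = y \/ y \notin S)) c; first by left.
  by move=> a b _ /and3P[_ bS _] _; right.
by case=> [->|//]; rewrite eqxx.
Qed.

Lemma connect_verts g x y : x \in verts g -> connect (adj g) x y -> y \in verts g.
Proof.
by move=> xg; apply: (connect_ind (P := fun y => y \in verts g)) => // a b _ /adj_vertsr.
Qed.

(** A connection can be shortened to a simple path, which never returns to [v] after its first
    step. *)
Lemma connect_step g S v x : connect (delete_adj g S) v x -> x != v ->
  exists w, [/\ adj g v w, w \notin S & connect (delete_adj g (v |: S)) w x].
Proof.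
case/connectP=> q0 pq ->; case/shortenP: pq => q + + _.
case: q => [|w q] /=; first by rewrite eqxx.
case/andP=> /and3P[vS wS vw] pq /andP[vq /andP[wq uq]] _.
exists w; split=> //; apply/connectP; exists q => //.
rewrite inE negb_or in vq; case/andP: vq => vw' vq.
elim: q w wS vw' {vw wq uq} pq vq => //= z q IHq w wS vw' /andP[/and3P[_ zS wz] pq].
rewrite inE negb_or => /andP[vz vq]; rewrite IHq // andbT.
by rewrite /delete_adj !inE !negb_or wz wS zS !(eq_sym _ v) vz vw'.
Qed.

Lemma connect_avoid g S u w x : ~~ connect (delete_adj g S) w u ->
  connect (delete_adj g S) w x -> connect (delete_adj g (u |: S)) w x.
Proof.
move=> nwu; apply: (connect_ind (P := connect (delete_adj g (u |: S)) w)) => // a b wa ab wa'.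
apply: connect_trans wa' _; apply: connect1.
have wb := connect_trans wa (connect1 ab).
case/and3P: ab => aS bS ab; rewrite /delete_adj ab !inE !negb_or aS bS !andbT.
by apply/andP; split; apply: contraNneq nwu => <-.
Qed.

Lemma branch_id g u v : v \in branch g u v.
Proof. by rewrite inE. Qed.

Lemma branch_notin g u v : adj g u v -> u \notin branch g u v.
Proof.
move=> uv; rewrite inE; apply/negP => /connect_del_notin.
by rewrite eq_sym (adj_neq uv) !inE eqxx => /(_ isT).
Qed.

Lemma in_branch g v x : connect (adj g) v x -> x != v ->
  exists2 w, adj g v w & x \in branch g v w.
Proof.
rewrite -connect_del0 => c /(connect_step c)[w [vw _ wx]].
by exists w; rewrite // inE; rewrite setU0 in wx.
Qed.

Lemma branch_step g u v x : x \in branch g u v -> x != v ->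
  exists w, [/\ adj g v w, w != u & x \in branch g v w].
Proof.
rewrite inE => c /(connect_step c)[w [vw wu wx]]; exists w; split=> //.
  by rewrite inE in wu.
by rewrite inE; apply: connect_delS wx; rewrite sub1set !inE eqxx.
Qed.

Lemma branch_inj g v w w' x : forest g -> adj g v w -> adj g v w' ->
  x \in branch g v w -> x \in branch g v w' -> w = w'.
Proof.
move=> fg vw vw'; rewrite !inE => c c'; apply: (fg v) => //.
by apply: connect_trans c _; rewrite connect_delC.
Qed.

(** Strictness comes from [v], which the smaller branch misses; the size of the branch is therefore
    a measure for walking away from [u]. *)
Lemma branch_sub g u v w : forest g -> adj g v u -> adj g v w -> w != u ->
  branch g v w \proper branch g u v.
Proof.
move=> fg vu vw wu; apply/properP; split; last first.
  by exists v; rewrite ?branch_id ?branch_notin.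
apply/subsetP=> x; rewrite !inE => wx.
have uw: u \notin [set v] by rewrite inE eq_sym (adj_neq vu).
have nwu : ~~ connect (delete_adj g [set v]) w u.
  by apply: contra wu => /(fg _ _ _ vw vu) ->.
have := connect_avoid nwu wx => {}wx.
apply: connect_trans (connect_delS _ wx); last by rewrite sub1set !inE eqxx.
by apply: connect1; rewrite /delete_adj vw !inE wu (adj_neq vu).
Qed.

Lemma branch_disjoint g u v x : forest g -> adj g u v ->
  x \in branch g u v -> x \in branch g v u -> False.
Proof.
move=> fg uv xuv xvu; have vu: adj g v u by rewrite adj_sym.
have xv : x != v by apply: contraTneq xvu => ->; rewrite branch_notin.
have [w [vw wu xw]] := branch_step xuv xv.
by move: wu; rewrite (branch_inj fg vw vu xw xvu) eqxx.
Qed.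

Lemma branch_cover g u v x : forest g -> connected g -> adj g u v -> x \in verts g ->
  (x \in branch g u v) = (x \notin branch g v u).
Proof.
move=> fg cg uv xg; have vu: adj g v u by rewrite adj_sym.
apply/idP/idP => [xuv|]; first by apply/negP => /(branch_disjoint fg uv xuv).
have [->|xv] := eqVneq x v; first by rewrite branch_id.
have [w vw xw] := in_branch (cg _ _ (adj_verts vu) xg) xv.
have [E|wu _] := eqVneq w u; first by rewrite -E xw.
by apply: (subsetP (proper_sub (branch_sub fg vu vw wu))).
Qed.

Lemma deg_gt0 g v w : adj g v w -> 0 < deg g v.
Proof. by move=> vw; apply/card_gt0P; exists w; rewrite inE. Qed.

Lemma leaf_nbr g v w w' : leaf g v -> adj g v w -> adj g v w' -> w = w'.
Proof.
move=> /eqP/mem_card1[u N]; have E z : adj g v z = (z == u) by have := N z; rewrite !inE.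
by rewrite !E => /eqP-> /eqP.
Qed.

Lemma leafP g v : leaf g v -> exists w, adj g v w.
Proof. by move=> /eqP/mem_card1[u N]; exists u; have := N u; rewrite !inE eqxx. Qed.

Lemma leaf_verts g v : leaf g v -> v \in verts g.
Proof. by case/leafP=> w /adj_verts. Qed.

Lemma nonleaf_nbr g v u : adj g v u -> ~~ leaf g v -> exists2 w, adj g v w & w != u.
Proof.
move=> vu nl; have: 1 < #|nbrs g v|.
  by rewrite ltn_neqAle eq_sym nl (deg_gt0 vu).
case/card_gt1P=> x [y []]; rewrite !inE => vx vy xy.
by have [E|] := eqVneq x u; [exists y; rewrite // -E eq_sym | exists x].
Qed.

Lemma branch_leaf g v w : forest g -> leaf g w -> adj g v w -> branch g v w = [set w].
Proof.
move=> fg lw vw; apply/setP => x; rewrite [RHS]inE; apply/idP/eqP => [xw|->]; last exact: branch_id.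
apply/eqP; apply: contraT => /(branch_step xw)[z [wz zv _]].
by move: zv; rewrite (leaf_nbr lw wz (_ : adj g w v)) ?eqxx // adj_sym.
Qed.

Lemma branch_has_leaf g u v : forest g -> adj g u v ->
  exists2 x, leaf g x & x \in branch g u v.
Proof.
move=> fg; have [n] := ubnP #|branch g u v|; elim: n u v => // n IHn u v Bn uv.
have vu: adj g v u by rewrite adj_sym.
case: (boolP (leaf g v)) => [lv|/(nonleaf_nbr vu)[w vw wu]].
  by exists v; rewrite ?branch_id.
have B := branch_sub fg vu vw wu; have := proper_card B => Bc.
have [|x lx xw] := IHn v w _ vw; first lia.
by exists x => //; apply: (subsetP (proper_sub B)).
Qed.

Lemma tree_nbr g v : tree g -> v \in verts g -> exists w, adj g v w.
Proof.
case=> cg _ /card_gt1P[x [y [xg yg xy]]] vg.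
have [z zg zv] : exists2 z, z \in verts g & z != v.
  by have [E|] := eqVneq x v; [exists y; rewrite // -E eq_sym | exists x].
by have [w vw _] := in_branch (cg _ _ vg zg) zv; exists w.
Qed.

Lemma tree_two_leaves g : tree g -> exists x y, [/\ leaf g x, leaf g y & x != y].
Proof.
move=> tg; have fg := tree_forest tg.
have /card_gt0P[v vg] : 0 < #|verts g| by apply: ltnW (tree_verts tg).
have [w vw] := tree_nbr tg vg; have wv: adj g w v by rewrite adj_sym.
have [x lx xw] := branch_has_leaf fg vw; have [y ly yv] := branch_has_leaf fg wv.
exists x, y; split=> //; apply: contraTneq xw => ->.
by apply/negP => /(branch_disjoint fg vw)/(_ yv).
Qed.

(** A vertex outside which only one leaf is seen along [vw] would otherwise have
    two further branches, as its degree is not 2. *)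
Lemma unique_leaf_branch g v w x : forest g -> deg g w != 2 -> adj g v w ->
  (forall y, leaf g y -> y \in branch g v w -> y = x) -> leaf g w.
Proof.
move=> fg d2 vw U; apply: contraT => nl; have wv: adj g w v by rewrite adj_sym.
have d3 : 2 < #|nbrs g w|.
  by have := deg_gt0 wv; move: nl d2; rewrite /leaf /deg; lia.
have [a [b [aw bw ab]]] : exists a b, [/\ a \in nbrs g w :\ v, b \in nbrs g w :\ v & a != b].
  by apply/card_gt1P; have := cardsD1 v (nbrs g w); rewrite inE wv; lia.
rewrite !inE in aw bw; case/andP: aw bw => av wa /andP[bv wb].
have [y ly ya] := branch_has_leaf fg wa; have [z lz zb] := branch_has_leaf fg wb.
have yx := U y ly (subsetP (proper_sub (branch_sub fg wv wa av)) y ya).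
have zx := U z lz (subsetP (proper_sub (branch_sub fg wv wb bv)) z zb).
by case/eqP: ab; apply: (branch_inj fg wa wb ya); rewrite yx -zx.
Qed.

Lemma end_supportI g v u w : adj g v u -> adj g v w -> w != u ->
  (forall z, adj g v z -> z != u -> leaf g z) -> end_support g v.
Proof.
move=> vu vw wu L; apply/andP; split.
  by apply/set0Pn; exists w; rewrite inE inE vw L.
have : nbrs g v :\ u \subset leaf_nbrs g v.
  by apply/subsetP => z; rewrite !inE => /andP[zu vz]; rewrite vz -/(leaf g z) L.
move=> /subset_leq_card; rewrite /deg (cardsD1 u (nbrs g v)) inE vu.
by rewrite add1n.
Qed.

(** Among the directed edges [uv] with [v] not a leaf, one with the smallest branch works: by
    [branch_sub] every neighbor of [v] other than [u] is a leaf. Without such an edge the tree is a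
    single edge, and either end will do. *)
Lemma end_support_exists g : tree g -> exists p, end_support g p.
Proof.
move=> tg; have fg := tree_forest tg.
have suppP v w : adj g v w -> leaf g w -> Defs.support g v.
  by move=> vw lw; apply/set0Pn; exists w; rewrite !inE vw.
pose P (e : V * V) := adj g e.1 e.2 && ~~ leaf g e.2.
case: (pickP P) => [e0 Pe0|nP]; last first.
  have [x [y [/leafP[w xw] _ _]]] := tree_two_leaves tg.
  have lw: leaf g w by move: (nP (x, w)); rewrite /P /= xw => /negbFE.
  have lx: leaf g x.
    by move: (nP (w, x)); rewrite /P /= adj_sym xw => /negbFE.
  by exists x; rewrite /end_support (suppP _ _ xw lw) (eqP lx).
case: (arg_minnP (fun e : V * V => #|branch g e.1 e.2|) Pe0) => -[u v] /= /andP[/= uv nv] min.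
have vu: adj g v u by rewrite adj_sym.
have L w : adj g v w -> w != u -> leaf g w.
  move=> vw wu; apply: contraT => nw.
  have := min (v, w); rewrite /P /= vw nw => /(_ isT).
  by have := proper_card (branch_sub fg vu vw wu); lia.
have [w vw wu] := nonleaf_nbr vu nv.
by exists v; apply: end_supportI vu vw wu L.
Qed.

End Graphs.

(** * Smoothing and deletion *)

Section Smooth.
Variable V : finType.
Implicit Types (g : graph V) (u v w x y z p : V) (S A : {set V}).

Lemma connect_smooth g u S x y : u \notin S -> x != u -> y != u ->
  connect (delete_adj (smooth g u) S) x y = connect (delete_adj g S) x y.
Proof.
move=> uS xu yu; apply/idP/idP.
  apply: connect_sub => a b /and3P[aS bS /and3P[au bu /orP[ab|/and3P[_ ua ub]]]].
    by apply: connect1; apply/and3P.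
  apply: (@connect_trans _ _ u); apply: connect1; apply/and3P; split=> //.
  by rewrite adj_sym.
pose c := connect (delete_adj (smooth g u) S) x.
(* The path may run through [u], which is absent from the smoothed graph; being at [u] is recorded
   as having reached one of its neighbors, from which the new edge leads on. *)
pose P z := if z == u then exists a, [/\ adj g u a, a \notin S & c a] else c z : Prop.
suff Q : connect (delete_adj g S) x y -> P y by move/Q; rewrite /P (negPf yu).
apply: (connect_ind (P := P)); first by rewrite /P (negPf xu); exact: connect0.
move=> a b _ /and3P[aS bS ab]; rewrite /P.
have [E|au] := eqVneq a u; have [E'|bu] := eqVneq b u.
- by move: ab; rewrite E E' adj_irr.
- case=> z [uz zS cz]; have [<-//|zb] := eqVneq z b.
  apply: connect_trans cz (connect1 _); apply/and3P; split=> //.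
  apply/and3P; split=> //; first by rewrite eq_sym (adj_neq uz).
  by rewrite zb uz -E ab orbT.
- by move=> ca; exists a; split=> //; rewrite adj_sym -E'.
- move=> ca; apply: connect_trans ca (connect1 _); apply/and3P; split=> //.
  by apply/and3P; rewrite ab.
Qed.

Lemma deg2P g u : deg g u = 2 ->
  exists x y, [/\ adj g u x, adj g u y, x != y & forall z, adj g u z -> z = x \/ z = y].
Proof.
rewrite /deg => /eqP/cards2P[x [y [xy N]]]; have E z : adj g u z = (z \in [set x; y]) by rewrite -N inE.
exists x, y; rewrite !E !inE !eqxx orbT; split=> // z; rewrite E !inE.
by case/orP=> /eqP; [left|right].
Qed.

Lemma forest_triangle g x y z : forest g -> adj g x y -> adj g y z -> ~~ adj g x z.
Proof.
move=> fg xy yz; apply/negP => xz; have := adj_neq yz.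
rewrite (fg x y z) ?eqxx //; apply: connect1; apply/and3P; rewrite !inE yz.
by rewrite eq_sym (adj_neq xy) eq_sym (adj_neq xz).
Qed.

(** A neighbor [v] of [u] exchanges [u] for the other neighbor [w] of [u]; this is a genuine gain
    because a forest has no triangle, so [w] was not adjacent to [v] before. *)
Lemma deg_smooth g u v : forest g -> deg g u = 2 -> v != u ->
  deg (smooth g u) v = deg g v.
Proof.
move=> fg d2 vu; have [x [y [ux uy xy N]]] := deg2P d2.
have irr a : adj g a u -> adj g u a by rewrite adj_sym.
case: (boolP (adj g u v)) => [uv|nuv]; last first.
  apply: eq_card => z; rewrite !inE /= /smooth_adj vu (negPf nuv) /= andbF orbF.
  by case: eqVneq => // ->; rewrite adj_sym (negPf nuv).
have [w [uw wv N']] : exists w, [/\ adj g u w, w != v & forall z, adj g u z -> z = v \/ z = w].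
  case: (N v uv) => E; first by exists y; rewrite E eq_sym.
  by exists x; rewrite E; split=> // z /N[]; auto.
have vw: ~~ adj g v w by apply: forest_triangle uw; rewrite // adj_sym.
have -> : deg (smooth g u) v = #|w |: (nbrs g v :\ u)|.
  apply: eq_card => z; rewrite !inE /= /smooth_adj vu uv /=.
  have [->|zw] := eqVneq z w; first by rewrite uw (eq_sym v) wv (eq_sym w) (adj_neq uw) orbT.
  case: (boolP (z == u)) => //= _; case: (boolP (adj g v z)) => //= _.
  by apply/negbTE/andP => -[vz /N'[E|/eqP]]; [rewrite E eqxx in vz | apply/negP].
rewrite cardsU1 !inE negb_and (negPf vw) orbT.
by rewrite /deg (cardsD1 u (nbrs g v)) inE adj_sym uv.
Qed.

Lemma deg_smooth_self g u : deg (smooth g u) u = 0.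
Proof. by apply: eq_card0 => z; rewrite !inE /= /smooth_adj eqxx. Qed.

Lemma leaf_smooth g u v : forest g -> deg g u = 2 ->
  leaf (smooth g u) v = leaf g v.
Proof.
move=> fg d2; have [->|vu] := eqVneq v u; last by rewrite /leaf deg_smooth.
by rewrite /leaf deg_smooth_self d2.
Qed.

Lemma forest_smooth g u : forest g -> deg g u = 2 -> forest (smooth g u).
Proof.
move=> fg d2 v w w' vw vw'; have [x [y [ux uy xy N]]] := deg2P d2.
have vu : v != u by case/and3P: vw.
have uv : u \notin [set v] by rewrite inE eq_sym.
have wu : w != u by case/and3P: vw.
have wu' : w' != u by case/and3P: vw'.
rewrite connect_smooth // => ww'.
(* Every edge at [v] in the smoothed graph stems from an edge [vt] of [g] pointing into the same
   component of [g] without [v]; for a new edge [t] is [u]. *)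
have phi z : adj (smooth g u) v z -> exists t, [/\ adj g v t,
    connect (delete_adj g [set v]) z t & z = t \/ t = u /\ adj g u z].
  case/and3P=> _ zu /orP[vz|/and3P[vz uv' uz]]; first by exists z; split=> //; left.
  exists u; split; [by rewrite adj_sym | | by right].
  by apply: connect1; apply/and3P; rewrite !inE (eq_sym z) vz (eq_sym u) vu adj_sym.
have [t [vt wt Ht]] := phi _ vw; have [t' [vt' wt' Ht']] := phi _ vw'.
have Et : t = t'.
  apply: (fg v) => //; rewrite connect_delC in wt.
  exact: connect_trans wt (connect_trans ww' wt').
case: Ht => [E|[E uw]]; case: Ht' => [E'|[E' uw']].
- by rewrite E E'.
- by rewrite E Et E' eqxx in wu.
- by rewrite E' -Et E eqxx in wu'.
(* Both edges are new: [v], [w] and [w'] are all neighbors of [u], which has only two, and [v]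
   differs from the others. *)
- have uv2 : adj g u v by rewrite adj_sym -E.
  have wv: w != v by rewrite eq_sym (adj_neq vw).
  have wv': w' != v by rewrite eq_sym (adj_neq vw').
  by move: wv wv'; case: (N _ uv2) => ->; case: (N _ uw) => ->; case: (N _ uw') => ->;
    rewrite ?eqxx.
Qed.

Lemma tree_smooth g u : tree g -> deg g u = 2 -> tree (smooth g u).
Proof.
case=> cg fg vg d2; split; last 2 first.
- exact: forest_smooth.
- have [x [y [ux uy xy N]]] := deg2P d2; apply/card_gt1P; exists x, y.
  by rewrite !inE (adj_vertsr ux) (adj_vertsr uy) !(eq_sym _ u) (adj_neq ux) (adj_neq uy).
move=> x y; rewrite !inE => /andP[xu xg] /andP[yu yg].
by rewrite -connect_del0 connect_smooth ?inE // connect_del0 cg.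
Qed.

Definition no_deg2 g := [forall v, deg g v != 2].

Lemma SM_id g : no_deg2 g -> SM g = g.
Proof.
move/forallP=> d2; rewrite /SM; suff -> : [set u in verts g | deg g u == 2] = set0.
  by rewrite enum_set0.
by apply/setP => u; rewrite !inE (negPf (d2 u)) andbF.
Qed.

(** [SM] fixes its list beforehand. The induction works because the rest of the list always consists
    of exactly the vertices of degree 2 of the current graph: the smoothed vertex drops to degree 0
    and the other degrees stay. *)
Lemma SM_ind (P : graph V -> Prop) g : tree g -> P g ->
  (forall h u, tree h -> deg h u = 2 -> P h -> P (smooth h u)) ->
  [/\ tree (SM g), no_deg2 (SM g) & P (SM g)].
Proof.
move=> tg Pg PS; rewrite /SM.
suff Q s h : tree h -> P h -> uniq s -> (forall u, (u \in s) = (deg h u == 2)) ->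
    [/\ tree (foldl (@smooth V) h s), no_deg2 (foldl (@smooth V) h s) &
        P (foldl (@smooth V) h s)].
  apply: Q; rewrite ?enum_uniq // => u; rewrite mem_enum inE.
  case: eqP; rewrite ?andbF // andbT => d2.
  by have [x [y [/adj_verts]]] := deg2P d2.
elim: s h => [|u s IHs] h th Ph /=.
  by move=> _ d2; split=> //; apply/forallP => u; rewrite -d2.
case/andP=> us us' d2; have du : deg h u = 2 by apply/eqP; rewrite -d2 mem_head.
apply: IHs => //; [exact: tree_smooth | exact: PS |].
move=> v; have [->|vu] := eqVneq v u; first by rewrite deg_smooth_self (negPf us).
by rewrite (deg_smooth (tree_forest th)) // -d2 inE (negPf vu).
Qed.

Lemma SM_empty g : verts g = set0 -> SM g = g.
Proof.
move=> g0; rewrite /SM; suff -> : [set u in verts g | deg g u == 2] = set0.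
  by rewrite enum_set0.
by apply/setP => u; rewrite !inE g0 inE.
Qed.

Lemma SM_verts g : verts (SM g) \subset verts g.
Proof.
rewrite /SM; move: (enum _) => s; elim: s g => //= u s IHs g; apply: subset_trans (IHs _) _.
exact: subsetDl.
Qed.

End Smooth.

(** * Removing an end support vertex and its leaves *)

Section Delete.
Variable V : finType.
Implicit Types (g : graph V) (u v w x y z p : V) (S A : {set V}).

(** The star removed by an iteration that chooses [p]. *)
Definition star g p : {set V} := p |: leaf_nbrs g p.

Lemma in_leaf_nbrs g p x : (x \in leaf_nbrs g p) = adj g p x && leaf g x.
Proof. by rewrite !inE. Qed.

Lemma star_exit g p a b : a \in star g p -> b \notin star g p -> adj g a b -> a = p.
Proof.
rewrite !in_setU1 in_leaf_nbrs => /orP[/eqP//|/andP[pa la]] nb ab.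
have bp : b = p by apply: (leaf_nbr la); rewrite // adj_sym.
by rewrite bp eqxx in nb.
Qed.

Lemma end_support_nonleaf g p x y : end_support g p ->
  adj g p x -> ~~ leaf g x -> adj g p y -> ~~ leaf g y -> x = y.
Proof.
case/andP=> _ d px nx py ny; apply/eqP; apply: contraTT d => xy; rewrite -ltnNge.
have : leaf_nbrs g p \subset nbrs g p :\ x :\ y.
  apply/subsetP => z; rewrite in_leaf_nbrs !inE => /andP[pz lz]; rewrite pz andbT.
  by apply/andP; split; apply: contraTneq lz => ->.
move/subset_leq_card; rewrite /deg (cardsD1 x (nbrs g p)) inE px.
by rewrite (cardsD1 y (nbrs g p :\ x)) !inE py (eq_sym y) xy /=; lia.
Qed.

(** With [star_exit], this says that the star is attached to the rest of the graph by at most one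
    edge, from [p] to a single outer vertex, its gate. *)
Lemma star_gate g p x y : end_support g p -> x \notin star g p -> y \notin star g p ->
  adj g p x -> adj g p y -> x = y.
Proof.
move=> es; rewrite !in_setU1 !in_leaf_nbrs !negb_or => /andP[_ nx] /andP[_ ny] px py.
by rewrite px in nx; rewrite py in ny; apply: (end_support_nonleaf es).
Qed.

Lemma connect_delete g p S x y : end_support g p ->
  x \notin star g p -> y \notin star g p ->
  connect (delete_adj (delete g (star g p)) S) x y = connect (delete_adj g S) x y.
Proof.
move=> es xA yA; apply/idP/idP.
  apply: connect_sub => a b /and3P[aS bS /and3P[_ _ ab]].
  by apply: connect1; apply/and3P.
pose c := connect (delete_adj (delete g (star g p)) S) x.
(* A path can enter and leave the star only through the gate; inside the star, it is remembered that
   the gate was already reached. *)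
pose P z := if z \in star g p then (forall q, q \notin star g p -> adj g p q -> c q)
            else c z : Prop.
suff Q : connect (delete_adj g S) x y -> P y by move/Q; rewrite /P (negPf yA).
apply: (connect_ind (P := P)); first by rewrite /P (negPf xA); exact: connect0.
move=> a b _ /and3P[aS bS ab]; rewrite /P.
case: (boolP (a \in star g p)) => aA; case: (boolP (b \in star g p)) => bA //.
- by move/(_ b bA); apply; rewrite -(star_exit aA bA ab).
- move=> ca q qA pq; have ba : adj g b a by rewrite adj_sym.
  rewrite (star_gate es qA aA pq) //; by rewrite -(star_exit bA aA ba).
- move=> ca; apply: connect_trans ca (connect1 _).
  by apply/and3P; split=> //; apply/and3P.
Qed.

Lemma forest_delete g A : forest g -> forest (delete g A).
Proof.
move=> fg v w w' /and3P[_ _ vw] /and3P[_ _ vw'] c; apply: (fg v) => //.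
by apply: connect_sub c => a b /and3P[aS bS /and3P[_ _ ab]]; apply: connect1; apply/and3P.
Qed.

Lemma deg_delete g p x q : x \notin star g p -> q \notin star g p -> adj g p q ->
  end_support g p -> deg g x = deg (delete g (star g p)) x + (x == q).
Proof.
move=> xA qA pq es; rewrite /deg (cardsD1 p (nbrs g x)) inE addnC; congr (_ + _).
  apply: eq_card => z; rewrite !inE /= /delete_adj xA /= in_setU1 in_leaf_nbrs negb_or.
  case: (boolP (z == p)) => //= zp; case: (boolP (adj g x z)) => [xz|]; rewrite ?andbF //.
  rewrite andbT; apply/esym/negP => /andP[pz lz].
  have : x = p by apply: (leaf_nbr lz); rewrite adj_sym.
  by move=> E; rewrite E in_setU1 eqxx in xA.
rewrite adj_sym; congr nat_of_bool; apply/idP/eqP => [px|->//].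
exact: (star_gate es xA qA px pq).
Qed.

Definition reduced g := verts g = set0 \/ tree g /\ no_deg2 g.

(** Only the gate [q] loses a neighbor. It is not a leaf and its degree is not 2, hence at least 3,
    so it keeps degree at least 2 and no new leaf arises. Without a gate the star is the whole
    tree. *)
Lemma delete_star g p : tree g -> no_deg2 g -> end_support g p ->
  let h := delete g (star g p) in
  verts h = set0 \/ tree h /\ forall x, leaf h x = leaf g x && (x \notin star g p).
Proof.
move=> tg /forallP d2 es /=; have [cg fg vg] := tg.
have pg : p \in verts g.
  by case/andP: es => /set0Pn[z]; rewrite in_leaf_nbrs => /andP[/adj_verts].
case: (pickP (fun q => adj g p q && (q \notin star g p))) => [q /andP[pq qA]|nq]; last first.
  left; apply/eqP; rewrite setD_eq0; apply/subsetP => x xg.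
  have : connect (adj g) p x by apply: cg.
  apply: (connect_ind (P := fun x => x \in star g p)); first by rewrite setU11.
  move=> a b _ ab aA; apply: contraT => bA; have := nq b.
  by rewrite bA andbT -(star_exit aA bA ab) ab.
have dq : 2 < deg g q.
  have := d2 q; have := deg_gt0 (_ : adj g q p); rewrite adj_sym => /(_ pq).
  have : ~~ leaf g q by apply: contra qA => lq; rewrite in_setU1 in_leaf_nbrs pq lq orbT.
  by rewrite /leaf; lia.
right; split; last first.
  move=> x; case: (boolP (x \in star g p)) => xA.
    rewrite andbF; apply/negP => /leafP[w]; by rewrite /= /delete_adj xA.
  rewrite andbT /leaf (deg_delete xA qA pq es).
  case: (x =P q) => [->|_]; last by rewrite addn0.
  by have := deg_delete qA qA pq es; rewrite eqxx; lia.
split; last 2 first.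
- exact: forest_delete.
- have [w] : exists w, w \in nbrs (delete g (star g p)) q.
    by apply/card_gt0P; have := deg_delete qA qA pq es; rewrite eqxx {2}/deg; lia.
  rewrite inE => qw; apply/card_gt1P; exists q, w.
  by rewrite (adj_verts qw) (adj_vertsr qw) (adj_neq qw).
move=> x y; rewrite !in_setD => /andP[xA xg] /andP[yA yg].
by rewrite -connect_del0 connect_delete // connect_del0 cg.
Qed.

Lemma end_support_verts g p : end_support g p -> p \in verts g.
Proof.
by case/andP=> /set0Pn[z]; rewrite in_leaf_nbrs => /andP[/adj_verts].
Qed.

End Delete.

(** * Geodesic-transversal sets *)

Section Transversal.
Variable V : finType.
Implicit Types (g : graph V) (u v w x y z p : V) (s q : seq V) (S A : {set V}).

(** Two distinct neighbors of [v] joined by a simple path avoiding [v] close up with [v] to a cycle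
    of length at least 3. *)
Lemma forest_of_tree g :
  (forall c, cycle (adj g) c -> uniq c -> size c <= 2) -> forest g.
Proof.
move=> nc v w w' vw vw' /connectP[q0 pq E]; move: E; case/shortenP: pq => q pq uq _ E.
have wv: w != v by rewrite eq_sym (adj_neq vw).
have qv : v \notin w :: q.
  rewrite inE negb_or eq_sym wv; elim: q w pq {uq E vw wv} => //= a q IHq w.
  by case/andP=> /and3P[_ av _] /IHq; rewrite in_cons negb_or in_set1 eq_sym in av *; rewrite av.
have pq' : path (adj g) w q by apply: sub_path pq => a b /and3P[].
case: q => [//|a q] in uq E qv pq pq' *.
have : cycle (adj g) (v :: w :: a :: q).
  rewrite (_ : cycle _ _ = path (adj g) v (rcons (w :: a :: q) v)) // rcons_path.
  by rewrite [last v _](esym E) [adj g w' v]adj_sym vw' andbT; apply/andP.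
by move/nc; rewrite cons_uniq qv uq => /(_ isT).
Qed.

Lemma is_treeP g : is_tree g -> 1 < #|verts g| -> tree g.
Proof. by case=> _ cg ng vg; split=> //; apply: forest_of_tree. Qed.

Lemma path_del g S x q : path (adj g) x q -> {in x :: q, forall z, z \notin S} ->
  path (delete_adj g S) x q.
Proof.
elim: q x => //= y q IHq x /andP[xy pq] nS; rewrite IHq ?andbT //.
  by apply/and3P; rewrite !nS ?inE ?eqxx ?orbT.
by move=> z zq; apply: nS; rewrite inE zq orbT.
Qed.

Lemma path_unique g x q q' : forest g ->
  path (adj g) x q -> uniq (x :: q) -> path (adj g) x q' -> uniq (x :: q') ->
  last x q = last x q' -> q = q'.
Proof.
move=> fg; elim: q x q' => [|y q IHq] x [|y' q'] //=.
- by move=> _ _ _ /andP[xq _] E; rewrite E mem_last in xq.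
- by move=> _ /andP[xq _] _ _ E; rewrite -E mem_last in xq.
move=> /andP[xy pq] /andP[xq uq] /andP[xy' pq'] /andP[xq' uq'] E.
have C z t : path (adj g) z t -> x \notin z :: t ->
    connect (delete_adj g [set x]) z (last z t).
  move=> pt xt; apply/connectP; exists t => //; apply: path_del => // a at_.
  by rewrite inE; apply: contraNneq xt => <-.
have Ey : y = y'.
  apply: (fg x) => //; apply: connect_trans (C _ _ pq xq) _.
  by rewrite connect_delC E; apply: C.
by rewrite -Ey in E pq' uq' *; rewrite (IHq y q').
Qed.

(** In a forest the simple path between two vertices is unique, so it is automatically shortest. *)
Lemma geodesicP g s : forest g -> geodesic g s <->
  [/\ s != [::], {subset s <= verts g}, sorted (adj g) s & uniq s].
Proof.
move=> fg; case: s => [|x q] /=; first by split=> [|[]].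
have path_verts y t : y \in verts g -> path (adj g) y t -> {subset y :: t <= verts g}.
  elim: t y => [|z t IHt] y yg /=; first by move=> _ w; rewrite inE => /eqP->.
  case/andP=> yz pt w; rewrite inE => /predU1P[->//|].
  by apply: IHt pt w; apply: adj_vertsr yz.
split=> [[/and3P[xg pq uq] _]|[_ sg pq uq]]; first by split=> //; apply: path_verts.
split; first by rewrite /is_path sg ?mem_head ?pq.
move=> q' /and3P[_ pq' uq'] E.
by rewrite (path_unique fg pq' uq' pq uq E).
Qed.

Lemma maximal_geodesic_rev g s : forest g ->
  maximal_geodesic g s -> maximal_geodesic g (rev s).
Proof.
have R t : forest g -> geodesic g t -> geodesic g (rev t).
  move=> fg /(geodesicP _ fg)[t0 tg st ut]; apply/(geodesicP _ fg); split.
  - by rewrite -size_eq0 size_rev size_eq0.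
  - by move=> z; rewrite mem_rev; apply: tg.
  - by rewrite rev_sorted (eq_sorted (e' := adj g)) // => a b; rewrite adj_sym.
  - by rewrite rev_uniq.
move=> fg [gs ms]; split; first exact: R.
case=> s' [gs' is' ss']; apply: ms; exists (rev s'); split; first exact: R.
  by rewrite -[s]revK infix_rev.
by rewrite size_rev -(size_rev s).
Qed.

(** A first vertex that is not a leaf has a neighbor [z] besides the second vertex. By acyclicity
    [z] is off the path, which can then be prolonged by [z]. *)
Lemma maximal_geodesic_leaf g x q : tree g -> maximal_geodesic g (x :: q) -> leaf g x.
Proof.
move=> tg [gs ms]; have fg := tree_forest tg.
have [_ sg pq uq] := (geodesicP _ fg).1 gs.
apply: contraT => nl; have [z xz zq] : exists2 z, adj g x z & z \notin x :: q.
  have [y xy] := tree_nbr tg (sg x (mem_head _ _)).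
  case: q => [|y' q] in sg pq uq {gs ms} *.
    by exists y; rewrite // inE eq_sym (adj_neq xy).
  case/andP: pq => xy'; rewrite -/(path _ _ _) => pq; have [z xz zy] := nonleaf_nbr xy' nl.
  exists z => //; rewrite in_cons negb_or eq_sym (adj_neq xz) /=.
  apply: contra zy => zq; apply/eqP; apply: (fg x) => //; rewrite connect_delC.
  move: zq; rewrite in_cons => /predU1P[->|zq]; first exact: connect0.
  case/andP: uq => xq _; case/splitPr: zq pq xq => q1 q2.
  rewrite cat_path => /= /and3P[pq1 lz _]; rewrite in_cons mem_cat in_cons !negb_or.
  case/and4P=> xy1 xq1 xz1 _.
  apply/connectP; exists (rcons q1 z); last by rewrite last_rcons.
  apply: path_del; first by rewrite rcons_path pq1.
  move=> t; rewrite !inE mem_rcons inE => H; apply: contraTneq H => ->.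
  by rewrite !negb_or xy1 xz1.
case: ms; exists (z :: x :: q); split; last by [].
  apply/(geodesicP _ fg); split.
  - by [].
  - by move=> t; rewrite in_cons => /predU1P[->|/sg//]; apply: adj_vertsr xz.
  - by apply/andP; rewrite adj_sym xz.
  - by rewrite cons_uniq zq.
by apply/infixP; exists [:: z], [::]; rewrite cats0.
Qed.

Lemma leaf_first g l x y r : leaf g x ->
  sorted (adj g) (l ++ [:: x, y & r]) -> uniq (l ++ [:: x, y & r]) -> l = [::].
Proof.
move=> lx; case/lastP: l => // l z; rewrite cat_rcons => /cat_sorted2[_ /and3P[zx xy _]].
rewrite cat_uniq => /and3P[_ _]; rewrite (leaf_nbr lx xy (_ : adj g x z)); last by rewrite adj_sym.
by rewrite /= !inE eqxx !orbT.
Qed.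

Lemma leaf_path_maximal g x y q : forest g -> leaf g x -> leaf g (last y q) ->
  geodesic g (x :: y :: q) -> maximal_geodesic g (x :: y :: q).
Proof.
move=> fg lx ly gs; split=> // -[s' [gs' /infixP[l [r E]] ss']].
have [_ _ ps us] := (geodesicP _ fg).1 gs'.
have l0 : l = [::] by apply: (leaf_first lx (y := y) (r := q ++ r)); rewrite -?E.
(* [leaf_first] treats the left end; the right end is handled by applying it to the reversed
   path. *)
have : rev r = [::].
  have Er : rev s' = rev r ++ rev (x :: y :: q) ++ rev l by rewrite E !rev_cat catA.
  have [t [a Et]] : exists t a, rev (x :: y :: q) = last y q :: a :: t.
    rewrite lastI rev_rcons /=; case Eb: (rev (x :: belast y q)) => [|a t]; last by exists t, a.
    by have := congr1 size Eb; rewrite size_rev.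
  apply: (leaf_first ly (y := a) (r := t ++ rev l)).
    rewrite -!cat_cons -Et -Er rev_sorted (eq_sorted (e' := adj g)) // => b c.
    by rewrite adj_sym.
  by rewrite -!cat_cons -Et -Er rev_uniq.
move=> /(congr1 size); rewrite size_rev => /size0nil r0.
by rewrite E l0 r0 cats0 ltnn in ss'.
Qed.

(** [S] is not confined to the vertices of [g], so that it can be moved between the successive
    graphs. A leaf in [S] counts as separated, since no edge is left at it. *)
Definition separating g S : Prop := forall a b,
  leaf g a -> leaf g b -> a != b -> ~~ connect (delete_adj g S) a b.

Lemma gt_transversalP g S : tree g ->
  gt_transversal g S <-> S \subset verts g /\ separating g S.
Proof.
move=> tg; have fg := tree_forest tg; split=> -[Sg tS]; split=> //.
  move=> a b la lb ab; apply/negP => /connectP[q0 pq0 E]; move: E ab lb.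
  case/shortenP: pq0 => q pq uq _ -> {b q0}.
  case: q => [|y q] in pq uq *; first by rewrite eqxx.
  move=> _ lb; have nS : {in [:: a, y & q], forall z, z \notin S}.
    move=> z; rewrite in_cons => /predU1P[->|]; first by case/andP: pq => /and3P[].
    elim: (y :: q) {lb uq la} a pq => //= t r IHr a' /andP[/and3P[_ tS' _] pr].
    by rewrite in_cons => /predU1P[->//|]; apply: IHr pr.
  have pq' : path (adj g) a (y :: q) by apply: sub_path pq => c d /and3P[].
  have ga : geodesic g [:: a, y & q].
    apply/(geodesicP _ fg); split=> // z.
    have ag := leaf_verts la; rewrite in_cons => /predU1P[->//|].
    elim: (y :: q) a pq' ag {pq uq la lb nS} => //= t r IHr a /andP[at_ pr] ag.
    by rewrite in_cons => /predU1P[->|]; [apply: adj_vertsr at_ | apply: IHr pr _; apply: adj_vertsr at_].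
  by have [x xq xS] := tS _ (leaf_path_maximal (y := y) fg la lb ga); move: (nS x xq); rewrite xS.
case=> [|x q] ms; first by case: ms.
have lx := maximal_geodesic_leaf tg ms.
have ly : leaf g (last x q).
  have := maximal_geodesic_rev fg ms; rewrite lastI rev_rcons.
  exact: maximal_geodesic_leaf.
have [_ _ pq uq] := (geodesicP _ fg).1 ms.1.
(* A geodesic with a single vertex is not maximal: it extends along the edge at the leaf [x]. *)
have xy : x != last x q.
  case: q => [|y q] in pq uq ly ms *; last first.
    have xq : x \notin y :: q by case/andP: uq.
    by apply: contraNneq xq => E; rewrite {1}E (mem_last y q).
  have [z xz] := leafP lx; case: ms => _ []; exists [:: x; z]; split=> //.
    apply/(geodesicP _ fg); split=> //; rewrite /= ?xz ?inE ?(adj_neq xz) //.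
    by move=> t; rewrite !inE => /orP[]/eqP->; rewrite ?(adj_verts xz) ?(adj_vertsr xz).
  by apply/infixP; exists [::], [:: z].
have [/hasP[z zq zS]|/hasPn nS] := boolP (has [in S] (x :: q)); first by exists z.
by case/negP: (tS _ _ lx ly xy); apply/connectP; exists q => //; apply: path_del.
Qed.

Lemma separating_smooth g u S : tree g -> deg g u = 2 -> S \subset verts (smooth g u) ->
  separating (smooth g u) S -> separating g S.
Proof.
move=> tg d2 Sg sS a b; have fg := tree_forest tg => la lb ab.
have uS : u \notin S by apply/negP => /(subsetP Sg); rewrite !inE eqxx.
rewrite -(@connect_smooth _ g u); first by apply: sS; rewrite ?leaf_smooth.
- exact: uS.
- by apply: contraTneq la => ->; rewrite /leaf d2.
- by apply: contraTneq lb => ->; rewrite /leaf d2.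
Qed.

(** A smoothed vertex of a separating set can be traded for one of its neighbors. *)
Lemma smooth_separating g u S : tree g -> deg g u = 2 -> separating g S ->
  exists2 S', separating (smooth g u) S' & #|S'| <= #|S|.
Proof.
move=> tg d2 sS; have fg := tree_forest tg.
have nu a : leaf g a -> a != u by apply: contraTneq => ->; rewrite /leaf d2.
case: (boolP (u \in S)) => uS; last first.
  exists S => // a b; rewrite !leaf_smooth // => la lb ab.
  by rewrite connect_smooth ?nu //; apply: sS.
have [x [y [ux uy xy N]]] := deg2P d2.
exists (x |: (S :\ u)); last by rewrite cardsU1 (cardsD1 u S) uS leq_add2r leq_b1.
move=> a b; rewrite !leaf_smooth // => la lb ab; apply: contra (sS a b la lb ab).
apply: connect_sub => c d /and3P[].
rewrite !inE !negb_or => /andP[cx cS] /andP[dx dS] /and3P[cu du].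
rewrite cu in cS; rewrite du in dS => /orP[cd|/and3P[cd uc ud]].
  by apply: connect1; apply/and3P.
(* The edge created by smoothing joins [x] and [y], and [x] is now deleted. *)
by move: cx dx cd; case: (N _ uc) => ->; case: (N _ ud) => ->; rewrite ?eqxx.
Qed.

Lemma separating_SM g : tree g ->
  [/\ tree (SM g), no_deg2 (SM g),
      forall x, leaf (SM g) x = leaf g x,
      forall S, S \subset verts (SM g) -> separating (SM g) S -> separating g S &
      forall S, separating g S -> exists2 S', separating (SM g) S' & #|S'| <= #|S|].
Proof.
move=> tg.
pose P h := [/\ forall x, leaf h x = leaf g x,
  forall S, S \subset verts h -> separating h S -> separating g S &
  forall S, separating g S -> exists2 S', separating h S' & #|S'| <= #|S|].
have [||? ? [? ? ?]] := @SM_ind _ P g tg; [by split=> // S ?; exists S | | by split].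
move=> h u th d2 [lh up dn]; have fh := tree_forest th; split.
- by move=> x; rewrite leaf_smooth.
- move=> S Sh sS; apply: up; last exact: separating_smooth sS.
  by apply: subset_trans Sh _; apply: subsetDl.
move=> S /dn[S1 sS1 le1]; have [S2 sS2 le2] := smooth_separating th d2 sS1.
by exists S2 => //; apply: leq_trans le1.
Qed.

Lemma separating_star g p S : tree g -> no_deg2 g -> end_support g p ->
  separating (delete g (star g p)) S -> separating g (p |: S).
Proof.
move=> tg d2 es sS a b la lb ab; apply/negP => c.
have out x y : x != y -> connect (delete_adj g (p |: S)) x y -> x \notin star g p.
  move=> xy c'; rewrite in_setU1 in_leaf_nbrs negb_or; apply/andP; split.
    have := connect_del_notin (_ : connect (delete_adj g (p |: S)) y x).
    by rewrite connect_delC eq_sym xy in_setU1 negb_or => /(_ c' isT)/andP[].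
  apply/negP => /andP[px lx].
  have [] := connect_step c'; first by rewrite eq_sym.
  move=> w [xw wp _]; move: wp; rewrite (leaf_nbr lx xw (_ : adj g x p)) 1?adj_sym //.
  by rewrite setU11.
have aA := out a b ab c.
have bA : b \notin star g p by apply: (out b a); rewrite 1?eq_sym // connect_delC.
have [h0|[th lh]] := delete_star tg d2 es.
  by move: (leaf_verts la) => ag; move: h0 => /setP/(_ a); rewrite in_setD in_set0 aA ag.
have := sS a b; rewrite !lh la lb aA bA => /(_ isT isT ab)/negP; apply.
by rewrite -(connect_delete _ es aA bA) in c; apply: connect_delS c; apply: subsetUr.
Qed.

Lemma star_separating g p S : tree g -> no_deg2 g -> end_support g p ->
  separating g S -> exists2 S', separating (delete g (star g p)) S' & #|S'| < #|S|.
Proof.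
move=> tg /forallP d2 es sS; exists (S :\: star g p).
  have [h0|[th lh]] := delete_star tg (introT forallP d2) es.
    by move=> a b /leaf_verts; rewrite h0 inE.
  move=> a b; rewrite !lh => /andP[la aA] /andP[lb bA] ab; apply: contra (sS a b la lb ab).
  apply: connect_sub => c d /and3P[cS dS /and3P[cA dA cd]].
  by apply: connect1; move: cS dS; rewrite /delete_adj !in_setD cA dA => -> ->.
rewrite (cardsD _ (star g p)) ltn_subrL.
suff: 0 < #|S :&: star g p| by have := subset_leq_card (subsetIl S (star g p)); lia.
rewrite lt0n cards_eq0; apply/negP => /eqP/setP S0.
have nS z : z \in star g p -> z \notin S.
  by move=> zA; move: (S0 z); rewrite in_setI in_set0 zA andbT => ->.
have nSl z : z \in leaf_nbrs g p -> z \notin S.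
  by move=> zl; apply: nS; rewrite in_setU1 zl orbT.
have pS : p \notin S by apply: nS; rewrite setU11.
case/andP: es => /set0Pn[a al] dp; have := al; rewrite in_leaf_nbrs => /andP[pa la].
have pa' : connect (delete_adj g S) a p.
  by apply: connect1; apply/and3P; rewrite nSl // adj_sym.
case: (boolP (leaf g p)) => lp.
  by have := sS a p la lp; rewrite eq_sym (adj_neq pa) pa' => /(_ isT).
(* Here [p] has degree at least 3, so at least two of its neighbors are leaves; a set missing the
   star would leave them connected through [p]. *)
have : 1 < #|leaf_nbrs g p|.
  by have := deg_gt0 pa; move: lp (d2 p) dp; rewrite /leaf; lia.
case/card_gt1P=> a' [b [al' bl ab]]; have := bl; have := al'.
rewrite !in_leaf_nbrs => /andP[pa2 la2] /andP[pb lb].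
case/negP: (sS a' b la2 lb ab); apply: (@connect_trans _ _ p); apply: connect1; apply/and3P.
  by rewrite nSl // adj_sym.
by rewrite (nSl b).
Qed.

Lemma alg_iter_reduced g S p : tree g -> no_deg2 g -> end_support g p ->
  reduced (alg_iter (S, g) p).2.
Proof.
move=> tg d2 es; rewrite /reduced /= -/(star g p).
have [h0|[th _]] := delete_star tg d2 es; first by left; rewrite SM_empty.
by right; have [] := separating_SM th.
Qed.

Lemma alg_choiceP g S p : reduced g -> alg_choice (S, g) p ->
  [/\ tree g, no_deg2 g & end_support g p].
Proof.
rewrite /alg_choice /= => -[->|[tg d2]]; first by rewrite cards0.
by rewrite SM_id // => /andP[_].
Qed.

Lemma alg_iter_verts g S p : end_support g p ->
  #|verts (alg_iter (S, g) p).2| < #|verts g|.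
Proof.
move=> es /=; apply: proper_card; apply: sub_proper_trans (SM_verts _) _.
apply/properP; split; first exact: subsetDl.
by exists p; [apply: end_support_verts | rewrite /= in_setD setU11].
Qed.

(** The length of the run is compared with both sides: it bounds the constructed set from above and
    every separating set from below. Minimality follows without proving that the choices are
    distinct. *)
Lemma alg_choices_spec s S0 g : reduced g -> alg_choices (S0, g) s ->
  let c := foldl (@alg_iter V) (S0, g) s in
  [/\ reduced c.2, size s + #|verts c.2| <= #|verts g| &
      verts c.2 = set0 -> exists S, [/\ c.1 = S0 :|: S, S \subset verts g,
        #|S| <= size s, separating g S & forall S', separating g S' -> size s <= #|S'|]].
Proof.
elim: s S0 g => [|p s IHs] S0 g rg /=.
  move=> _; split=> // g0; exists set0; rewrite setU0 sub0set cards0; split=> //.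
  by move=> a b /leaf_verts; rewrite g0 inE.
case/andP=> /(alg_choiceP rg)[tg d2 es].
have rh := alg_iter_reduced S0 tg d2 es; have lth := alg_iter_verts S0 es.
set c := alg_iter (S0, g) p in rh lth *; have -> : c = (c.1, c.2) by [].
move=> /(IHs _ _ rh)[rs les sol]; split=> //; first by apply: leq_trans lth; rewrite addSn ltnS.
move=> /sol[S [ES Sh leS sepS minS]]; exists (p |: S).
have dS : S \subset verts (delete g (star g p)) by apply: subset_trans Sh (SM_verts _).
split.
- by rewrite ES /c /= -setUA setUCA.
- rewrite subUset sub1set end_support_verts //; apply: subset_trans dS _.
  exact: subsetDl.
- by rewrite cardsU1 -[(size s).+1]add1n leq_add ?leq_b1.
- apply: separating_star => //; have [h0|[th _]] := delete_star tg d2 es.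
    by move=> a b /leaf_verts; rewrite h0 inE.
  by have [_ _ _ up _] := separating_SM th; apply: up sepS.
- move=> S1 /(star_separating tg d2 es)[S2 sS2 lt2].
  apply: leq_trans lt2; rewrite ltnS; have [h0|[th _]] := delete_star tg d2 es.
    by apply: minS; rewrite /c /= -/(star g p) SM_empty.
  have [_ _ _ _ dn] := separating_SM th; have [S3 sS3 le3] := dn _ sS2.
  by apply: leq_trans le3; apply: minS.
Qed.

Lemma alg_run_spec g s : tree g -> alg_run g s ->
  [/\ reduced (alg_state g s).2, size s <= #|verts g| &
      alg_halted g s -> gt_set g (alg_state g s).1].
Proof.
move=> tg rs; have [tr d2 lr up dn] := separating_SM tg.
have [|r le sol] := alg_choices_spec _ rs; first by right.
split=> //.
  have := subset_leq_card (SM_verts g); apply: leq_trans.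
  by apply: leq_trans le; apply: leq_addr.
rewrite /alg_halted cards_eq0 => /eqP/sol[S [ES Sg leS sepS minS]].
rewrite /gt_set /alg_state ES set0U; split.
  apply/gt_transversalP => //; split; last exact: up.
  exact: subset_trans Sg (SM_verts g).
move=> S' /(gt_transversalP _ tg)[_ /dn[S1 /minS le1 leS1]].
exact: leq_trans leS (leq_trans le1 leS1).
Qed.

Lemma alg_choices_rcons c s p : alg_choices c (rcons s p) =
  alg_choices c s && alg_choice (foldl (@alg_iter V) c s) p.
Proof. by elim: s c => [|q s IHs] c /=; rewrite ?andbT // IHs andbA. Qed.

Lemma alg_run_progress g s : tree g -> alg_run g s -> ~~ alg_halted g s ->
  exists p, alg_run g (rcons s p).
Proof.
move=> tg rs; have [] := alg_run_spec tg rs; rewrite /alg_halted => r _ _ nh.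
case: r => [h0|[th d2]]; first by rewrite h0 cards0 in nh.
have [p es] := end_support_exists th; exists p; rewrite /alg_run alg_choices_rcons.
by apply/andP; split=> //; rewrite /alg_choice -/(alg_state g s) lt0n nh SM_id.
Qed.

End Transversal.

(** * A run that treats children before parents *)

Section Refines.
Variable V : finType.
Implicit Types (g : graph V) (u v w x y z p : V) (s q : seq V) (S A : {set V}).

Lemma branch_connect g v w x y :
  x \in branch g v w -> y \in branch g v w -> connect (delete_adj g [set v]) x y.
Proof. by rewrite !inE => cx; apply: connect_trans; rewrite connect_delC. Qed.

Lemma connect_branch g v w x y :
  x \in branch g v w -> connect (delete_adj g [set v]) x y -> y \in branch g v w.
Proof. by rewrite !inE; apply: connect_trans. Qed.

Lemma tree_branch g v x : tree g -> v \in verts g -> x \in verts g -> x != v ->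
  exists2 w, adj g v w & x \in branch g v w.
Proof. by case=> cg _ _ vg xg; apply: in_branch; apply: cg. Qed.

Lemma leaf_delete_star g p x : tree g -> no_deg2 g -> end_support g p ->
  leaf (delete g (star g p)) x = leaf g x && (x \notin star g p).
Proof.
move=> tg d2 es; have [h0|[_ ->//]] := delete_star tg d2 es.
apply/idP/andP => [/leaf_verts|[/leaf_verts xg xA]]; first by rewrite h0 inE.
by move/setP/(_ x): h0; rewrite in_setD in_set0 xA xg.
Qed.

Lemma leaf_alg_iter S g p x : tree g -> no_deg2 g -> end_support g p ->
  leaf (alg_iter (S, g) p).2 x = leaf g x && (x \notin star g p).
Proof.
move=> tg d2 es /=; rewrite -/(star g p) -leaf_delete_star //.
have [h0|[th _]] := delete_star tg d2 es; first by rewrite SM_empty.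
by have [_ _ ->] := separating_SM th.
Qed.

(** Seen from a vertex of the star, everything outside lies in one branch: a leaf has only one
    branch, and from [p] the way out is the gate. *)
Lemma star_inside g p v x y : tree g -> end_support g p ->
  x \in verts g -> y \in verts g -> x \notin star g p -> y \notin star g p ->
  v \in star g p -> connect (delete_adj g [set v]) x y.
Proof.
move=> tg es xg yg xA yA vA; have fg := tree_forest tg.
have neq z : z \notin star g p -> z != v by apply: contraNneq => ->.
have vg : v \in verts g.
  move: vA; rewrite in_setU1 in_leaf_nbrs => /predU1P[->|/andP[/adj_vertsr//]].
  exact: end_support_verts.
have [w vw xw] := tree_branch tg vg xg (neq x xA).
have [w' vw' yw'] := tree_branch tg vg yg (neq y yA).
suff E : w = w' by rewrite -E in yw'; apply: branch_connect xw yw'.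
move: vA; rewrite in_setU1 in_leaf_nbrs => /predU1P[Ev|/andP[_ lv]]; last exact: leaf_nbr vw vw'.
rewrite {}Ev in vw vw' xw yw'.
have out z u : z \notin star g p -> adj g p u -> z \in branch g p u -> u \notin star g p.
  move=> zA pu zu; rewrite in_setU1 in_leaf_nbrs negb_or eq_sym (adj_neq pu) pu /=.
  apply: contra zA => lu; move: zu; rewrite branch_leaf // inE => /eqP->.
  by rewrite in_setU1 in_leaf_nbrs pu lu orbT.
by apply: (star_gate es _ _ vw vw'); [apply: out xw | apply: out yw'].
Qed.

(** [h] has the shape of [g] around its own leaves: the vertices it keeps
    separate these leaves as in [g], and the vertices that are gone do not
    separate any three of them. *)
Record refines g h : Prop := Refines {
  refines_leaf : forall x, leaf h x -> leaf g x;
  refines_in : forall v a b, v \in verts h -> leaf h a -> leaf h b ->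
    connect (delete_adj h [set v]) a b = connect (delete_adj g [set v]) a b;
  refines_out : forall v a b c, v \in verts g -> v \notin verts h ->
    leaf h a -> leaf h b -> leaf h c ->
    [\/ connect (delete_adj g [set v]) a b, connect (delete_adj g [set v]) b c |
        connect (delete_adj g [set v]) a c] }.

Lemma refines_refl g : refines g g.
Proof. by split=> // v a b c ->. Qed.

(** For the newly lost vertex [u] this is the pigeonhole principle: three leaves lie in the two
    branches at [u], so two of them share one. *)
Lemma refines_smooth g h u : tree h -> deg h u = 2 -> refines g h ->
  refines g (smooth h u).
Proof.
move=> th d2 [rl ri ro]; have fh := tree_forest th.
have nu a : leaf h a -> a != u by apply: contraTneq => ->; rewrite /leaf d2.
have [x [y [ux uy xy N]]] := deg2P d2; have uh := adj_verts ux.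
split.
- by move=> z; rewrite leaf_smooth //; apply: rl.
- move=> v a b; rewrite !leaf_smooth // in_setD1 => /andP[vu vh] la lb.
  by rewrite connect_smooth ?nu ?inE 1?eq_sym // ri.
move=> v a b c vg; rewrite !leaf_smooth // in_setD1 negb_and negbK.
case: (eqVneq v u) => [-> _|_ /= vh]; last exact: ro.
move=> la lb lc; rewrite -!ri //.
have B z : leaf h z -> z \in branch h u x \/ z \in branch h u y.
  move=> lz; have [w uw] := tree_branch th uh (leaf_verts lz) (nu z lz).
  by case: (N _ uw) => ->; [left|right].
case: (B a la) => Ba; case: (B b lb) => Bb; case: (B c lc) => Bc;
by do [apply: Or31; solve [apply: branch_connect; eassumption]
     | apply: Or32; solve [apply: branch_connect; eassumption]
     | apply: Or33; solve [apply: branch_connect; eassumption]].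
Qed.

Lemma refines_SM g h : tree h -> refines g h -> refines g (SM h).
Proof.
move=> th rh; have [//|_ _ //] := SM_ind (P := refines g) th rh.
by move=> k u tk d2; apply: refines_smooth.
Qed.

(** By [star_inside], a vertex lost with the star does not even separate two of the leaves that
    remain. *)
Lemma refines_alg_iter g S h p : tree h -> no_deg2 h -> end_support h p ->
  refines g h -> refines g (alg_iter (S, h) p).2.
Proof.
move=> th d2 es [rl ri ro] /=; rewrite -/(star h p).
have lk x := leaf_delete_star x th d2 es.
have R : refines g (delete h (star h p)).
  split.
  - by move=> x; rewrite lk => /andP[/rl].
  - move=> v a b; rewrite !lk in_setD => /andP[vA vh] /andP[la aA] /andP[lb bA].
    by rewrite connect_delete // ri.
  move=> v a b c vg; rewrite !lk in_setD negb_and negbK.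
  case: (boolP (v \in star h p)) => [vA _|vA /= vh /andP[la _] /andP[lb _] /andP[lc _]];
    last exact: ro.
  move=> /andP[la aA] /andP[lb bA] _; apply: Or31; rewrite -ri //.
    by apply: (star_inside th es) => //; apply: leaf_verts.
  move: vA; rewrite in_setU1 in_leaf_nbrs => /predU1P[->|/andP[/adj_vertsr//]].
  exact: end_support_verts.
have [h0|[tk _]] := delete_star th d2 es; first by rewrite SM_empty.
exact: refines_SM.
Qed.

End Refines.

(** * Rooted trees and the invariant of the bottom-up run *)

Section Rooted.
Variables (V : finType) (T : graph V) (r : V).
Hypotheses (tT : tree T) (lr : leaf T r).
Implicit Types (u v w x y z p c : V) (s q : seq V) (S A D : {set V}).

Let fT := tree_forest tT.
Let cT := tree_connected tT.
Let rT := leaf_verts lr.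

(** The neighbor on the side of the root. At [r] itself no neighbor qualifies, and the value is the
    default [r]. *)
Definition parent v : V := odflt r [pick u | adj T v u && (r \in branch T v u)].
Definition child u w : bool := [&& adj T u w, w != r & parent w == u].
Definition subtree v : {set V} := if v == r then verts T else branch T (parent v) v.

Lemma parentP v : v \in verts T -> v != r -> adj T v (parent v) /\ r \in branch T v (parent v).
Proof.
move=> vT vr; rewrite /parent; case: pickP => [u /andP[]//|nu].
have [|w vw rw] := tree_branch tT vT rT; first by rewrite eq_sym.
by have := nu w; rewrite vw rw.
Qed.

Lemma parentE v u : v \in verts T -> v != r -> adj T v u -> r \in branch T v u -> parent v = u.
Proof. by move=> vT vr vu ru; have [vp rp] := parentP vT vr; apply: branch_inj rp ru. Qed.

Lemma childP u w : adj T u w -> (u == r) || (w != parent u) -> child u w.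
Proof.
move=> uw H; have wu : adj T w u by rewrite adj_sym.
have wT := adj_verts wu; have uT := adj_verts uw.
have nr : r \notin branch T u w.
  have [E|ur] := eqVneq u r; first by rewrite -E branch_notin.
  rewrite (negPf ur) /= in H; apply: contra H => rw.
  by rewrite (parentE uT ur uw rw).
have wr : w != r by apply: contraNneq nr => <-; rewrite branch_id.
have rw : r \in branch T w u by rewrite (branch_cover fT cT wu rT).
by rewrite /child uw wr (parentE wT wr wu rw) eqxx.
Qed.

Lemma child_subtree u w : child u w -> subtree w = branch T u w.
Proof. by case/and3P=> _ /negPf wr /eqP E; rewrite /subtree wr E. Qed.

Lemma subtree_id v : v \in verts T -> v \in subtree v.
Proof. by move=> vT; rewrite /subtree; case: eqP => // _; apply: branch_id. Qed.

Lemma subtree_step v x : v \in verts T -> x \in subtree v -> x != v ->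
  exists2 c, child v c & x \in subtree c.
Proof.
move=> vT; rewrite {1}/subtree; case: eqP => [Ev xT xv|/eqP vr xB xv].
  have [w vw xw] := tree_branch tT vT xT xv; have ch : child v w by apply: childP; rewrite // Ev eqxx.
  by exists w; rewrite // (child_subtree ch).
have [w [vw wp xw]] := branch_step xB xv.
have ch : child v w by apply: childP; rewrite ?wp ?orbT.
by exists w; rewrite // (child_subtree ch).
Qed.

Lemma notin_subtree v x : v \in verts T -> v != r -> x \in verts T ->
  (x \notin subtree v) = (x \in branch T v (parent v)).
Proof.
move=> vT vr xT; have [vp _] := parentP vT vr.
by rewrite /subtree (negPf vr) (branch_cover fT cT vp).
Qed.

Lemma child_proper u w : child u w -> subtree w \proper subtree u.
Proof.
move=> ch; have [uw wr _] := and3P ch; rewrite (child_subtree ch).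
have uT := adj_verts uw; rewrite /subtree; case: eqP => [Eu|/eqP ur].
  apply/properP; split; last by exists u; rewrite ?branch_notin.
  apply/subsetP => x; rewrite inE => /connect_del; apply: connect_verts.
  exact: adj_vertsr uw.
have [up _] := parentP uT ur; apply: branch_sub => //.
have [_ ru] := parentP uT ur; have [_ rw] := parentP (adj_vertsr uw) wr.
have rn : r \notin branch T u w.
  by rewrite -(child_subtree ch) notin_subtree ?(adj_vertsr uw).
by apply: contraNneq rn => ->.
Qed.

Lemma children_disjoint v c c' x : child v c -> child v c' ->
  x \in subtree c -> x \in subtree c' -> c = c'.
Proof.
move=> ch ch'; rewrite (child_subtree ch) (child_subtree ch').
by case/and3P: ch => vc _ _; case/and3P: ch' => vc' _ _; apply: branch_inj.
Qed.

Definition child_closed D := D \subset verts T /\ forall v c, v \in D -> child v c -> c \in D.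

Lemma child_closed_subtree D v : child_closed D -> v \in D -> subtree v \subset D.
Proof.
case=> DT clD; have [n] := ubnP #|subtree v|; elim: n v => // n IHn v ltn vD.
apply/subsetP => x xv; have [->//|nxv] := eqVneq x v.
have [c vc xc] := subtree_step (subsetP DT v vD) xv nxv.
have := proper_card (child_proper vc) => ltc.
by apply: (subsetP (IHn c _ (clD v c vD vc))) => //; lia.
Qed.

(** Whether [v] was chosen or not, at most one leaf below it survives, so each
    child contributes at most one leaf to the count at its parent. *)
Definition rstep (st : {set V} * seq V) v : {set V} * seq V :=
  if 1 < #|st.1 :&: subtree v| then (st.1 :\: subtree v, rcons st.2 v) else st.

(** [D] is the set of treated vertices, [A] the leaves not dropped so far, [s] the choices made. The
    second case of [rinv_alive] is the end of the run: the last star may contain a leaf outside the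
    chosen subtree, which leaves the tree but stays in [A]. *)
Record rinv D (A : {set V}) s : Prop := Rinv {
  rinv_leaf : forall x, x \in A -> leaf T x;
  rinv_todo : forall x, leaf T x -> x \notin D -> x \in A;
  rinv_done : forall v, v \in D -> #|A :&: subtree v| <= 1;
  rinv_closed : child_closed D;
  rinv_run : alg_run T s;
  rinv_refines : refines T (alg_state T s).2;
  rinv_alive : (forall x, leaf (alg_state T s).2 x = (x \in A)) \/
    verts (alg_state T s).2 = set0 /\ #|A| <= 1 }.

Lemma rinv_init : rinv set0 [set x | leaf T x] [::].
Proof.
have [t2 d2 lS _ _] := separating_SM tT; split.
- by move=> x; rewrite inE.
- by move=> x; rewrite inE.
- by move=> v; rewrite inE.
- by split; [exact: sub0set | move=> v c; rewrite inE].
- by [].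
- exact: refines_SM tT (refines_refl T).
- by left=> x; rewrite inE lS.
Qed.

Section Choice.
Variables (D A : {set V}) (s : seq V) (v : V) (g : graph V).
Hypotheses (invA : rinv D A s) (vT : v \in verts T) (vD : v \notin D).
Hypotheses (chD : forall c, child v c -> c \in D) (two : 1 < #|A :&: subtree v|).
Hypotheses (tg : tree g) (d2 : no_deg2 g) (rg : refines T g).
Hypothesis lg : forall x, leaf g x = (x \in A).

Let fg := tree_forest tg.

(** A child-closed set containing the root contains every vertex, whereas [v] is untreated. Hence
    [r] itself is still a surviving leaf. *)
Let rD : r \notin D.
Proof.
apply: contra vD => rD; apply: (subsetP (child_closed_subtree (rinv_closed invA) rD)).
by rewrite /subtree eqxx.
Qed.

Let rA : leaf g r. Proof. by rewrite lg (rinv_todo invA). Qed.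

Let leaf_child c x y : child v c -> leaf g x -> leaf g y ->
  x \in subtree c -> y \in subtree c -> x = y.
Proof.
move=> ch; rewrite !lg => xA yA xc yc.
by apply: (card_le1_eqP (rinv_done invA (chD ch))); rewrite !inE ?xA ?yA.
Qed.

(** The root has one child, below which at most one leaf survives. The current tree thus has two
    leaves and no vertex of degree 2: it is a single edge. *)
Lemma choice_root : v = r -> end_support g v /\ forall x, leaf g x -> x \in star g v.
Proof.
move=> Ev; have lv : leaf T v by rewrite Ev.
have vA : leaf g v by rewrite Ev.
have [w vw] := leafP vA.
have U x y : leaf g x -> leaf g y -> x != v -> y != v -> x = y.
  have B z : leaf g z -> z != v -> exists2 c, child v c & z \in subtree c.
    move=> /(refines_leaf rg)/leaf_verts zT zv.
    by apply: subtree_step => //; rewrite /subtree Ev eqxx.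
  move=> lx ly xv yv; have [c vc xc] := B x lx xv; have [c' vc' yc'] := B y ly yv.
  have E : c = c' by case/and3P: vc => vc _ _; case/and3P: vc' => vc' _ _; apply: leaf_nbr vc vc'.
  by rewrite -E in yc'; apply: leaf_child xc yc'.
have [l ll lw] := branch_has_leaf fg vw.
have nv z : z \in branch g v w -> z != v.
  by apply: contraTneq => ->; rewrite branch_notin.
have leafw : leaf g w.
  apply: (unique_leaf_branch fg (forallP d2 w) vw (x := l)) => y ly yw.
  by apply: U; rewrite ?nv.
have wS : w \in leaf_nbrs g v by rewrite in_leaf_nbrs vw.
split; first by rewrite /end_support (eqP vA) andbT; apply/set0Pn; exists w.
move=> x lx; rewrite in_setU1; have [->//|xv] := eqVneq x v.
by rewrite (U x w) ?wS ?orbT //; apply: nv; apply: branch_id.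
Qed.

Lemma choice_nonroot : v != r ->
  [/\ end_support g v,
      forall x, leaf g x -> x \in subtree v -> x \in star g v &
      (forall x, leaf g x -> x \notin subtree v -> x \notin star g v) \/
      exists w, forall x, leaf g x -> x \in star g v /\ (x \notin subtree v -> x = w)].
Proof.
move=> vr; have [vp rp] := parentP vT vr.
have lgT x : leaf g x -> x \in verts T by move/(refines_leaf rg)/leaf_verts.
have out x : x \in verts T -> (x \notin subtree v) = (x \in branch T v (parent v)).
  exact: notin_subtree.
have nlv : ~~ leaf T v.
  apply: contraL two => lv; rewrite /subtree (negPf vr) branch_leaf //; last by rewrite adj_sym.
  by rewrite -leqNgt -(cards1 v); apply: subset_leq_card (subsetIr _ _).
have nv x : leaf g x -> x != v.
  by move=> lx; apply: contraNneq nlv => E; rewrite -E; apply: (refines_leaf rg).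
have down x : leaf g x -> x \in subtree v -> exists2 c, child v c & x \in branch T v c.
  move=> lx xv; have [c ch xc] := subtree_step vT xv (nv x lx).
  by exists c; rewrite // -(child_subtree ch).
have same x y : leaf g x -> leaf g y -> x \in subtree v ->
    connect (delete_adj T [set v]) x y -> x = y.
  move=> lx ly xv cxy; have [c ch xc] := down x lx xv.
  by apply: (leaf_child ch) => //; rewrite (child_subtree ch) //; apply: connect_branch cxy.
have notr x : leaf g x -> x \in subtree v -> ~~ connect (delete_adj T [set v]) x r.
  move=> lx xv; apply/negP => c; move: xv; apply/negP; rewrite out ?lgT //.
  by apply: connect_branch rp _; rewrite connect_delC.
have [a1 [a2 [/setIP[a1A a1v] /setIP[a2A a2v] a12]]] := card_gt1P two.
rewrite -!lg in a1A a2A.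
(* In [T], the vertex [v] separates [a1], [a2] and [r] from each other: the first two lie below
   different children and [r] lies above. *)
have vg : v \in verts g.
  apply: contraT => nvg; case: (refines_out rg vT nvg a1A a2A rA).
  - by move/(same _ _ a1A a2A a1v)/eqP; rewrite (negPf a12).
  - by rewrite (negPf (notr _ a2A a2v)).
  - by rewrite (negPf (notr _ a1A a1v)).
have ri := refines_in rg vg.
have gb x : leaf g x -> exists2 w, adj g v w & x \in branch g v w.
  by move=> lx; apply: tree_branch; rewrite ?nv // leaf_verts.
have [w0 vw0 rw0] := gb r rA.
have side x w : leaf g x -> adj g v w -> x \in branch g v w -> w != w0 -> x \in subtree v.
  move=> lx vw xw; apply: contraNT; rewrite out ?lgT // => xp.
  have : connect (delete_adj g [set v]) x r by rewrite ri //; apply: branch_connect xp rp.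
  by move/(connect_branch xw) => rw; rewrite (branch_inj fg vw vw0 rw rw0).
(* A branch of the current tree that avoids the root lies, as far as leaves go, below a single
   child, so it has one leaf and collapses to it. *)
have lside w : adj g v w -> w != w0 -> leaf g w.
  move=> vw ww0; have [l ll lw] := branch_has_leaf fg vw.
  apply: (unique_leaf_branch fg (forallP d2 w) vw (x := l)) => y ly yw.
  apply: same => //; first exact: side yw ww0.
  by rewrite -ri //; apply: branch_connect yw lw.
have leaf_side x w : leaf g x -> adj g v w -> x \in branch g v w -> w != w0 -> x = w.
  by move=> lx vw xw ww0; move: xw; rewrite branch_leaf ?lside // inE => /eqP.
have downg x w : leaf g x -> x \in subtree v -> adj g v w -> x \in branch g v w -> w != w0.
  move=> lx xv vw xw; apply: contraNneq (notr x lx xv) => E; rewrite E in xw.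
  by rewrite -ri //; apply: branch_connect xw rw0.
have starI w : adj g v w -> leaf g w -> w \in star g v.
  by move=> vw lw; rewrite in_setU1 in_leaf_nbrs vw lw orbT.
split.
- have [w1 vw1 a1w] := gb a1 a1A; have w10 := downg _ _ a1A a1v vw1 a1w.
  exact: end_supportI vw0 vw1 w10 lside.
- move=> x lx xv; have [w vw xw] := gb x lx; have ww0 := downg _ _ lx xv vw xw.
  by rewrite (leaf_side x w) // starI // lside.
have up x : leaf g x -> x \notin subtree v -> x \in branch g v w0.
  move=> lx xv; have [w vw xw] := gb x lx; have [<-//|ww0] := eqVneq w w0.
  by rewrite (side x w) in xv.
(* If the neighbor [w0] towards the root is a leaf, the whole current tree is the star of [v] and
   disappears, including [w0], which is then [r]. *)
case: (boolP (leaf g w0)) => lw0; [right; exists w0 | left] => x lx; last first.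
  move=> xv; have xw0 := up x lx xv; rewrite in_setU1 in_leaf_nbrs negb_or nv //=.
  apply/negP => /andP[vx _]; move: lw0.
  by rewrite -(branch_inj fg vx vw0 (branch_id g v x) xw0) lx.
have xw0 : x \notin subtree v -> x = w0.
  by move=> /(up x lx); rewrite branch_leaf // inE => /eqP.
split=> //; have [w vw xw] := gb x lx; have [E|ww0] := eqVneq w w0.
  by move: xw; rewrite E branch_leaf // inE => /eqP->; apply: starI.
by rewrite (leaf_side x w) // starI // lside.
Qed.

End Choice.

Lemma rinv_step D A s v : rinv D A s -> v \in verts T -> v \notin D ->
  (forall c, child v c -> c \in D) ->
  rinv (v |: D) (rstep (A, s) v).1 (rstep (A, s) v).2.
Proof.
move=> invA vT vD chD; have [rl rt rd rc rr rf ra] := invA.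
have rc' : child_closed (v |: D).
  case: rc => DT clD; split; first by rewrite subUset sub1set vT.
  move=> w c; rewrite in_setU1 => /predU1P[->|wD] ch; rewrite in_setU1.
    by rewrite chD ?orbT.
  by rewrite (clD w) ?orbT.
rewrite /rstep /=; case: ltnP => two /=; last first.
  split=> //.
  - by move=> x lx; rewrite in_setU1 negb_or => /andP[_]; apply: rt.
  - by move=> w; rewrite in_setU1 => /predU1P[->|]; [|apply: rd].
have [red _ _] := alg_run_spec tT rr.
case: ra => [lg|[_ A1]]; last first.
  by have := subset_leq_card (subsetIl A (subtree v)); lia.
case/card_gt0P: (ltnW two) => x0 /setIP[x0A _].
case: red => [g0|[tg d2]]; first by have := x0A; rewrite -lg => /leaf_verts; rewrite g0 inE.
set g := (alg_state T s).2 in lg rf tg d2 *.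
have [es sub alive] : [/\ end_support g v,
    forall x, leaf g x -> x \in subtree v -> x \in star g v &
    (forall x, leaf g x -> x \notin subtree v -> x \notin star g v) \/
    exists w, forall x, leaf g x -> x \in star g v /\ (x \notin subtree v -> x = w)].
  have [vr|vr] := eqVneq v r; last exact: (choice_nonroot invA).
  have [es sub] := choice_root invA vT vD chD tg d2 rf lg vr.
  split=> //; first by move=> x lx _; apply: sub.
  by left=> x /(refines_leaf rf)/leaf_verts xT; rewrite vr /subtree eqxx xT.
have Est : alg_state T s = ((alg_state T s).1, g) by rewrite /g; case: (alg_state T s).
have Est' : alg_state T (rcons s v) = alg_iter ((alg_state T s).1, g) v.
  by rewrite -Est /alg_state foldl_rcons.
have lk x := leaf_alg_iter (alg_state T s).1 x tg d2 es.
have rr' : alg_run T (rcons s v).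
  rewrite /alg_run alg_choices_rcons -/(alg_run T s) rr -/(alg_state T s) Est.
  rewrite /alg_choice /= SM_id // es andbT.
  by apply: ltnW (tree_verts tg).
split=> //.
- by move=> x /setDP[xA _]; apply: rl.
- move=> x lx; rewrite in_setU1 negb_or => /andP[xv xD]; rewrite in_setD rt // andbT.
  apply/negP => xsv; have [c ch xc] := subtree_step vT xsv xv.
  by rewrite (subsetP (child_closed_subtree rc (chD c ch))) in xD.
- move=> w; rewrite in_setU1 => /predU1P[->|wD].
    by rewrite setIDAC -setIDA setDv setI0 cards0.
  apply: leq_trans (rd w wD); apply: subset_leq_card; apply: setSI; exact: subsetDl.
- by rewrite Est'; apply: refines_alg_iter.
rewrite Est'; case: alive => [alive|[w alive]]; [left|right].
  move=> x; rewrite lk in_setD -lg andbC; case lx: (leaf g x); rewrite ?andbF ?andbT //.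
  by apply/idP/idP; apply: contra; [apply: sub | apply: contraLR; apply: alive].
split.
  (* A nonempty next tree would have a leaf, but all current leaves belong to the removed star. *)
  have := alg_iter_reduced (alg_state T s).1 tg d2 es; case=> [//|[th _]].
  have [x [_ [lx _ _]]] := tree_two_leaves th; move: lx; rewrite lk.
  by case/andP=> /alive[->].
rewrite -(cards1 w); apply: subset_leq_card; apply/subsetP => x /setDP[xA xv].
by rewrite inE; have [_ ->] := alive x (etrans (lg x) xA).
Qed.

(** A nonempty final tree would have two leaves, both surviving below the root, where [rinv_done]
    allows only one. *)
Lemma rinv_final A s : rinv (verts T) A s -> alg_run T s && alg_halted T s.
Proof.
case=> rl rt rd rc rr rf ra; rewrite rr /alg_halted cards_eq0 /=.
have [[/eqP//|[tg d2]] _ _] := alg_run_spec tT rr.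
case: ra => [lg|[/eqP//]].
have [x [y []]] := tree_two_leaves tg; rewrite !lg => xA yA xy.
have /card_le1_eqP/(_ x y) := rd r rT; rewrite /subtree eqxx !inE.
rewrite xA yA !(leaf_verts (rl _ _)) // => /(_ isT isT) E.
by rewrite E eqxx in xy.
Qed.

End Rooted.

(** * Breadth-first order and the counters of surviving leaves *)

Section Counters.
Variables (V : finType) (T : graph V) (r : V).
Hypotheses (tT : tree T) (lr : leaf T r).
Implicit Types (u v w x y z p c : V) (s q : seq V) (S A D : {set V}).

Let fT := tree_forest tT.
Let cT := tree_connected tT.
Let rT := leaf_verts lr.
Local Notation child := (child T r).
Local Notation subtree := (subtree T r).
Local Notation parent := (parent T r).

Lemma childE v w : adj T v w -> child v w = (v == r) || (w != parent v).
Proof.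
move=> vw; apply/idP/idP => [ch|]; last exact: (childP tT lr).
have [//|vr /=] := eqVneq v r; have [_ rp] := parentP tT lr (adj_verts vw) vr.
have [_ wr _] := and3P ch.
have rw := (parentP tT lr (adj_vertsr vw) wr).2.
rewrite -(notin_subtree tT lr (adj_vertsr vw) wr rT) (child_subtree ch) in rw.
by apply: contraNneq rw => ->.
Qed.

Lemma child_parent v w : child v w -> v = parent w.
Proof. by case/and3P=> _ _ /eqP. Qed.

Lemma parent_child v : v \in verts T -> v != r -> child (parent v) v.
Proof.
move=> vT vr; have [vp _] := parentP tT lr vT vr.
by apply/and3P; rewrite adj_sym vp vr eqxx.
Qed.

(** Each vertex has at most one parent next to its children, and each vertex is a child of at most
    one other. This bounds the length of the input. *)
Lemma sum_deg : \sum_v deg T v <= 2 * #|V|.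
Proof.
have le v : deg T v <= 1 + \sum_w child v w.
  have -> : \sum_w child v w = #|[set w | child v w]|.
    by rewrite -sum1dep_card [RHS]big_mkcond; apply: eq_bigr => w _; case: (child v w).
  apply: leq_trans (_ : #|parent v |: [set w | child v w]| <= _).
    apply: subset_leq_card; apply/subsetP => w; rewrite !inE => vw.
    by rewrite childE // orbCA orbN orbT.
  by rewrite cardsU1 leq_add2r leq_b1.
apply: (@leq_trans (\sum_v (1 + \sum_w child v w))).
  by apply: leq_sum => v _; apply: le.
rewrite big_split /= sum1_card mul2n -addnn leq_add2l exchange_big /=.
rewrite -sum1_card; apply: leq_sum => w _.
rewrite (bigD1 (parent w)) //= big1 ?addn0 ?leq_b1 // => v.
by apply: contraNeq; rewrite eqb0 negbK => /child_parent ->.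
Qed.

(** [q] lists the vertices discovered by the search from [r] after the first [h]
    of them have been expanded. *)
Record bfs h q : Prop := Bfs {
  bfs_size : h <= size q;
  bfs_uniq : uniq q;
  bfs_verts : {subset q <= verts T};
  bfs_mem : forall w, w \in q <-> w = r \/ exists2 v, v \in take h q & child v w;
  bfs_order : forall v c, child v c -> v \in q -> c \in q -> index v q < index c q }.

Lemma bfs_init : bfs 0 [:: r].
Proof.
split=> //.
- by move=> v; rewrite inE => /eqP->.
- by move=> w; rewrite inE; split=> [/eqP|[->|[v]]]; [left | rewrite eqxx |].
- by move=> v c /and3P[_ cr _]; rewrite !inE (negPf cr).
Qed.

Lemma bfs_step h q l : bfs h q -> h < size q -> uniq l ->
  (forall w, w \in l = child (nth r q h) w) -> bfs h.+1 (q ++ l).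
Proof.
case=> _ uq qT mq oq hq ul ml; set v := nth r q h in ml.
have vq : v \in q by apply: mem_nth.
have Et : take h.+1 (q ++ l) = rcons (take h q) v.
  by rewrite takel_cat // (take_nth r).
have vt : v \notin take h q.
  by move: uq; rewrite -{1}(cat_take_drop h.+1 q) (take_nth r) // cat_uniq rcons_uniq -andbA => /andP[].
(* A child of [v] found earlier would have been found from an expanded parent, but its only parent
   [v] is not expanded yet. *)
have lq w : w \in l -> w \notin q.
  rewrite ml => ch; apply/negP => /mq[E|[u ut ch']].
    by case/and3P: ch; rewrite E eqxx.
  by move: vt; rewrite (child_parent ch) -(child_parent ch') ut.
split.
- by rewrite size_cat; lia.
- by rewrite cat_uniq uq ul andbT; apply/hasPn => w /lq.
- by move=> w; rewrite mem_cat ml => /orP[/qT//|/and3P[/adj_vertsr]].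
- move=> w; rewrite mem_cat Et ml; split.
    case/orP=> [/mq[->|[u ut ch]]|ch]; [by left | right; exists u | right; exists v] => //.
      by rewrite mem_rcons inE ut orbT.
    by rewrite mem_rcons mem_head.
  case=> [->|[u]]; first by apply/orP; left; apply/mq; left.
  rewrite mem_rcons inE => /predU1P[-> ->|ut ch]; first by rewrite orbT.
  by apply/orP; left; apply/mq; right; exists u.
move=> u c ch; rewrite !mem_cat !index_cat.
case: (boolP (u \in q)) => uqq /=; last first.
  move=> ul' /orP[cq|cl].
    case/mq: cq => [E|[u' ut' ch']]; first by case/and3P: ch; rewrite E eqxx.
    by move: uqq; rewrite (child_parent ch) -(child_parent ch') (mem_take ut').
  by move: uqq; rewrite ml in cl; rewrite (child_parent ch) -(child_parent cl) vq.
case: (boolP (c \in q)) => [cq _ _|_ _ cl]; first exact: oq.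
rewrite -index_mem in uqq; exact: leq_trans uqq (leq_addr _ _).
Qed.

Lemma bfs_final q : bfs (size q) q -> q =i verts T.
Proof.
case=> _ uq qT mq _ x; apply/idP/idP => [/qT//|xT]; rewrite take_size in mq.
have cl : child_closed T r [set v in q].
  split; first by apply/subsetP => v; rewrite inE => /qT.
  by move=> v c; rewrite !inE => vq ch; apply/mq; right; exists v.
have rq : r \in [set v in q] by rewrite inE; apply/mq; left.
have := subsetP (child_closed_subtree tT lr cl rq) x.
by rewrite /subtree eqxx inE => /(_ xT).
Qed.

(** The value of the counter of [u] once the vertices of [D] are processed. *)
Definition pending D A u : nat :=
  #|[set c in D | child u c && (A :&: subtree c != set0)]|.

Lemma pending_leq D A u : pending D A u <= #|V|.
Proof. exact: max_card. Qed.

Section Pending.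
Variables (D A : {set V}) (s : seq V) (v : V).
Hypotheses (invA : rinv T r D A s) (vT : v \in verts T) (vD : v \notin D).
Hypothesis chD : forall c, child v c -> c \in D.

(** Sending a surviving leaf below [v] to the child above it is injective, because at most one leaf
    survives below each child. The summand [leaf T v] accounts for [v] itself. *)
Lemma card_subtree : #|A :&: subtree v| = leaf T v + pending D A v.
Proof.
rewrite (cardsD1 v) inE (subtree_id _ vT) andbT.
have -> : (v \in A) = leaf T v.
  by apply/idP/idP; [apply: (rinv_leaf invA) | move/(rinv_todo invA); apply].
congr (_ + _); pose f x := odflt v [pick c | child v c && (x \in subtree c)].
have fP x : x \in (A :&: subtree v) :\ v -> child v (f x) /\ x \in subtree (f x).
  rewrite !inE => /and3P[xv _ xs]; have [c ch xc] := subtree_step tT lr vT xs xv.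
  by rewrite /f; case: pickP => [c' /andP[]//|/(_ c)]; rewrite ch xc.
rewrite /pending -(card_in_imset (f := f) (D := [in (A :&: subtree v) :\ v])).
  apply: eq_card => c; rewrite inE; apply/imsetP/and3P.
    case=> x xA ->; have [ch xs] := fP x xA; split; rewrite ?chD //.
    by apply/set0Pn; exists x; move: xA; rewrite !inE xs andbT => /and3P[].
  case=> cD ch /set0Pn[x /setIP[xA xc]]; have sub := proper_sub (child_proper tT lr ch).
  have xI : x \in (A :&: subtree v) :\ v.
    rewrite !inE xA (subsetP sub _ xc) andbT andbT; apply: contraNneq vD => Ex.
    rewrite -Ex; apply: (subsetP (child_closed_subtree tT lr (rinv_closed invA) cD)) xc.
  exists x => //; have [ch' xs] := fP x xI.
  exact: (children_disjoint tT ch ch' xc xs).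
move=> x y xI yI E; have [ch xc] := fP x xI; have [_ yc] := fP y yI; rewrite -E in yc.
have H := card_le1_eqP (rinv_done invA (chD ch)); apply/esym; apply: H.
  by rewrite in_setI xc andbT; case/setD1P: xI => _ /setIP[].
by rewrite in_setI yc andbT; case/setD1P: yI => _ /setIP[].
Qed.

(** Dropping the leaves below [v] therefore does not disturb what the counters of untreated vertices
    record about other children. *)
Lemma subtree_disjoint u c x : u \notin v |: D -> c \in D -> child u c ->
  x \in subtree v -> x \notin subtree c.
Proof.
rewrite in_setU1 negb_or => /andP[uv uD] cD ch xv; apply/negP => xc.
have vc : v \notin subtree c.
  by apply: contra vD; apply: (subsetP (child_closed_subtree tT lr (rinv_closed invA) cD)).
have vr : v != r.
  apply: contraNneq uD => Ev; have [uc _ _] := and3P ch.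
  have us : u \in subtree v by rewrite /subtree Ev eqxx (adj_verts uc).
  have [d chd ud] := subtree_step tT lr vT us uv.
  exact: (subsetP (child_closed_subtree tT lr (rinv_closed invA) (chD chd))).
have us : u \notin subtree v.
  apply: contra uD => us; have [d chd ud] := subtree_step tT lr vT us uv.
  exact: (subsetP (child_closed_subtree tT lr (rinv_closed invA) (chD chd))).
move: us xv vc xc; rewrite (child_subtree ch) /subtree (negPf vr) !inE => us xv vc xc.
case/negP: vc; apply: connect_trans xc _; rewrite connect_delC.
by apply: connect_delS (connect_avoid us xv); rewrite sub1set setU11.
Qed.

(** With two or more leaves below, [v] is chosen and they are dropped; so [v] contributes to its
    parent exactly when the count is 1. *)
Lemma pending_step u : u \notin v |: D -> let A' := (rstep T r (A, s) v).1 in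
  pending (v |: D) A' u = pending D A u + (child u v && (#|A :&: subtree v| == 1)).
Proof.
move=> uD' A'.
have Ev : (A' :&: subtree v != set0) = (#|A :&: subtree v| == 1).
  rewrite /A' /rstep /=; case: ltnP => /= [two|one].
    by rewrite setIDAC -setIDA setDv setI0 eqxx; lia.
  by rewrite -card_gt0; lia.
have Ec c : c \in D -> child u c -> A' :&: subtree c = A :&: subtree c.
  move=> cD ch; rewrite /A' /rstep /=; case: ifP => //= _.
  apply/setP => x; rewrite !inE; case: (boolP (x \in subtree c)) => xc; rewrite ?andbF // !andbT.
  case: (boolP (x \in subtree v)) => //= xv.
  by move: (subtree_disjoint uD' cD ch xv); rewrite xc.
rewrite /pending -Ev; rewrite (cardsD1 v) inE setU11 /= addnC; congr (_ + _).
apply: eq_card => c; rewrite !inE; have [->|cv] := eqVneq c v; first by rewrite (negPf vD).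
by case: (boolP (c \in D)) => cD //=; case: (boolP (child u c)) => ch //=; rewrite Ec.
Qed.

End Pending.
End Counters.

(** * Programs *)

(** Total correctness: the execution exists, so halting and the word bound are included, and [Q]
    also receives the number of steps. *)
Definition wp W c s (Q : nat -> state -> Prop) : Prop :=
  exists t s', exec W c s t s' /\ Q t s'.

Section Wp.
Variable W : nat.
Implicit Types (s : state) (Q : nat -> state -> Prop) (c : cmd).

Lemma wp_const r k s Q : k < W -> Q 1 (set_reg s r k) -> wp W (Const r k) s Q.
Proof. by exists 1, (set_reg s r k); split=> //; constructor. Qed.

Lemma wp_add r a b s Q : regs s a + regs s b < W ->
  Q 1 (set_reg s r (regs s a + regs s b)) -> wp W (Add r a b) s Q.
Proof. by move=> lt q; do 2!eexists; split; [constructor|exact: q]. Qed.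

Lemma wp_sub r a b s Q : regs s a - regs s b < W ->
  Q 1 (set_reg s r (regs s a - regs s b)) -> wp W (Defs.Sub r a b) s Q.
Proof. by move=> lt q; do 2!eexists; split; [constructor|exact: q]. Qed.

Lemma wp_read r a s Q v : Defs.mem s (regs s a) = v -> regs s a < W -> v < W ->
  Q 1 (set_reg s r v) -> wp W (Read r a) s Q.
Proof. by move=> <- lt lt' q; do 2!eexists; split; [constructor|exact: q]. Qed.

Lemma wp_write a b s Q : regs s a < W -> regs s b < W ->
  Q 1 (set_mem s (regs s a) (regs s b)) -> wp W (Write a b) s Q.
Proof. by move=> lt lt' q; do 2!eexists; split; [constructor|exact: q]. Qed.

Lemma wp_seq c1 c2 s Q :
  wp W c1 s (fun t1 s1 => wp W c2 s1 (fun t2 s2 => Q (t1 + t2) s2)) ->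
  wp W (Seq c1 c2) s Q.
Proof.
case=> t1 [s1 [e1 [t2 [s2 [e2 q]]]]]; exists (t1 + t2), s2; split=> //.
exact: ExecSeq e1 e2.
Qed.

Lemma wp_if a b c1 c2 s Q :
  (regs s a < regs s b -> wp W c1 s (fun t => Q t.+1)) ->
  (regs s b <= regs s a -> wp W c2 s (fun t => Q t.+1)) ->
  wp W (IfLt a b c1 c2) s Q.
Proof.
case: (ltnP (regs s a) (regs s b)) => lt H1 H2.
  by have [t [s' [e q]]] := H1 isT; exists t.+1, s'; split=> //; apply: ExecIfTrue.
by have [t [s' [e q]]] := H2 isT; exists t.+1, s'; split=> //; apply: ExecIfFalse.
Qed.

Lemma wp_mono c s Q Q' : wp W c s Q -> (forall t s', Q t s' -> Q' t s') -> wp W c s Q'.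
Proof. by case=> t [s' [e q]] H; exists t, s'; split=> //; apply: H. Qed.

(** The potential [phi] of the ghost state [x] pays for the steps. *)
Lemma wp_while (X : Type) (I : X -> state -> Prop) (phi : X -> nat) a b c x s Q :
  (forall x s, I x s -> regs s a < regs s b ->
     wp W c s (fun t s' => exists2 x', I x' s' & t.+1 + phi x' <= phi x)) ->
  I x s ->
  (forall t x' s', I x' s' -> regs s' b <= regs s' a -> t + phi x' <= (phi x).+1 ->
     Q t s') ->
  wp W (WhileLt a b c) s Q.
Proof.
move=> step Ix; have [m] := ubnP (phi x); elim: m x s Q Ix => // m IHm x s Q Ix ltm post.
case: (ltnP (regs s a) (regs s b)) => lt; last first.
  by exists 1, s; split; [apply: ExecWhileStop | apply: post Ix lt _; rewrite add1n].
have [t1 [s1 [e1 [x1 I1 le1]]]] := step x s Ix lt.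
have [||t2 [s2 [e2 q]]] := IHm x1 s1 (fun t s' => Q (t1 + t).+1 s') I1; first by lia.
  by move=> t x' s' I' lt' le'; apply: post I' lt' _; lia.
by exists (t1 + t2).+1, s2; split=> //; apply: ExecWhileLoop e1 e2.
Qed.

End Wp.

(** * Addresses in the encoded input *)

Section Encode.
Variables (n : nat) (L : 'I_n -> seq 'I_n).

Definition offset k : nat := n.+2 + sumn (take k [seq size (L v) | v <- enum 'I_n]).

Let ls := [seq [seq val w | w <- L v] | v <- enum 'I_n].

Let shape_ls : shape ls = [seq size (L v) | v <- enum 'I_n].
Proof. by rewrite /shape /ls -map_comp; apply: eq_map => v /=; rewrite size_map. Qed.

Let offs := [seq n.+2 + sumn (take v (shape ls)) | v <- iota 0 n.+1].

Let encE : encode L = n :: (offs ++ flatten ls). Proof. by []. Qed.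

Let size_offs : size offs = n.+1. Proof. by rewrite size_map size_iota. Qed.

Lemma encode_offset k : k <= n -> nth 0 (encode L) k.+1 = offset k.
Proof.
move=> kn; rewrite encE -[LHS]/(nth 0 (offs ++ flatten ls) k) nth_cat size_offs ltnS kn.
by rewrite (nth_map 0) ?size_iota ?ltnS // nth_iota ?ltnS // shape_ls.
Qed.

Lemma offsetS (v : 'I_n) : offset v.+1 = offset v + size (L v).
Proof.
rewrite /offset (take_nth 0); last by rewrite size_map size_enum_ord.
by rewrite sumn_rcons addnA (nth_map v) ?size_enum_ord // nth_ord_enum.
Qed.

Lemma offset_homo j k : j <= k -> offset j <= offset k.
Proof.
move=> jk; rewrite leq_add2l -(subnKC jk) takeD sumn_cat; exact: leq_addr.
Qed.

Lemma offset_max : offset n = n.+2 + \sum_v size (L v).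
Proof.
rewrite /offset take_oversize; last by rewrite size_map size_enum_ord.
by rewrite sumnE big_map big_enum.
Qed.

Lemma encode_list (v : 'I_n) j : j < size (L v) ->
  nth 0 (encode L) (offset v + j) = nth v (L v) j.
Proof.
move=> jL; have vs : v < size ls by rewrite size_map size_enum_ord.
have nls : nth [::] ls v = [seq val w | w <- L v].
  by rewrite (nth_map v) ?size_enum_ord // nth_ord_enum.
rewrite encE /offset !addSn -[LHS]/(nth 0 (offs ++ flatten ls) _.+1) nth_cat size_offs.
rewrite ifF; last by lia.
rewrite (_ : _ - _ = flatten_index (shape ls) v j); last first.
  by rewrite /flatten_index shape_ls; lia.
have jS : j < nth 0 (shape ls) v.
  by rewrite (nth_map [::]) // nls size_map.
by rewrite nth_flatten flatten_indexKl // flatten_indexKr // nls (nth_map v).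
Qed.

(** The memory after the input starts at 0, which serves as the initial value of the counters. *)
Lemma encode_default k : offset n <= k -> nth 0 (encode L) k = 0.
Proof.
move=> le; rewrite nth_default //; apply: leq_trans le.
rewrite encE -[size _]/(size (offs ++ flatten ls)).+1 size_cat size_offs size_flatten shape_ls.
by rewrite /offset take_oversize // size_map size_enum_ord.
Qed.

End Encode.

(** * The program *)

Local Notation "c1 ';;' c2" := (Seq c1 c2) (at level 85, right associativity).

(** Registers 2, 3 and 4 hold [n], 1 and 0; registers 5, 6, 7 and 0 point to the
    queue, the parents, the counters and the output; register 8 holds the
    current vertex. *)
Definition setup_cmd : cmd :=
  Const 3 1 ;; Read 2 4 ;; Add 11 2 3 ;; Read 5 11 ;;
  Add 6 5 2 ;; Add 7 6 2 ;; Add 0 7 2 ;; Add 0 0 3.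

Definition degree_cmd : cmd :=
  Add 11 8 3 ;; Read 12 11 ;; Add 11 11 3 ;; Read 13 11 ;; Defs.Sub 14 13 12.

(** A linear search for a vertex of degree at most 1, starting at vertex 0. No test for the end of
    the vertex range is made, since a tree has a leaf. *)
Definition root_cmd : cmd :=
  degree_cmd ;; WhileLt 3 14 (Add 8 8 3 ;; degree_cmd).

Definition push_cmd : cmd :=
  Add 11 5 10 ;; Write 11 15 ;; Add 10 10 3 ;; Add 11 6 15 ;; Write 11 8.

(** Subtraction is truncated, so the two differences of the neighbor and the parent are added: the
    sum is positive exactly when the neighbor is not the parent. *)
Definition scan_cmd : cmd :=
  Read 15 12 ;; Defs.Sub 11 15 16 ;; Defs.Sub 17 16 15 ;; Add 11 11 17 ;;
  IfLt 4 11 push_cmd (Const 11 0) ;; Add 12 12 3.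

Definition fetch_cmd : cmd := Add 11 5 9 ;; Read 8 11 ;; degree_cmd.

(** The root gets the parent [n], which is not a vertex. *)
Definition search_cmd : cmd :=
  Write 5 8 ;; Add 11 6 8 ;; Write 11 2 ;; Const 10 1 ;;
  WhileLt 9 10
    (fetch_cmd ;; Add 11 6 8 ;; Read 16 11 ;; WhileLt 12 13 scan_cmd ;; Add 9 9 3).

Definition choose_cmd : cmd := Add 11 0 1 ;; Write 11 8 ;; Add 1 1 3.

Definition notify_cmd : cmd :=
  Add 11 6 8 ;; Read 11 11 ;; Add 11 7 11 ;; Read 12 11 ;; Add 12 12 3 ;; Write 11 12.

(** Register 9 still holds the length of the queue after the search and runs down, so the queue is
    read backwards. Register 15 receives the counter, plus 1 at a leaf. *)
Definition select_cmd : cmd :=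
  WhileLt 4 9
    (Defs.Sub 9 9 3 ;; fetch_cmd ;; Add 11 7 8 ;; Read 15 11 ;;
     IfLt 3 14 (Const 11 0) (Add 15 15 3) ;;
     IfLt 3 15 choose_cmd (IfLt 4 15 notify_cmd (Const 11 0))).

Definition gt_cmd : cmd := setup_cmd ;; root_cmd ;; search_cmd ;; select_cmd.

(** * Correctness and running time of the program *)

Section Program.
Variables (n : nat) (T : graph 'I_n) (L : 'I_n -> seq 'I_n) (W : nat).
Hypotheses (tT : tree T) (VT : verts T = [set: 'I_n]) (n1 : 1 < n).
Hypotheses (aL : adj_lists T L) (hW : 200 * n <= W).
Implicit Types (u v w : 'I_n) (q : seq 'I_n) (st : state).

(** The end of the input. Behind it lie [n] cells for the queue, [n] for the parents, [n + 1] for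
    the counters, then the output. *)
Local Notation B := (offset L n).

Let inT v : v \in verts T. Proof. by rewrite VT inE. Qed.

Lemma size_list v : size (L v) = deg T v.
Proof.
have [uL mL] := aL v; rewrite /deg -(card_uniqP uL).
by apply: eq_card => w; rewrite inE mL.
Qed.

(** There are [n + 2] cells before the lists and, by [sum_deg], at most [2 * n] in them. This keeps
    all addresses linear in [n]. *)
Lemma base_leq : B <= 3 * n + 2.
Proof.
have Es : \sum_v size (L v) = \sum_v deg T v by apply: eq_bigr => v _; apply: size_list.
rewrite offset_max Es.
have [r [_ [lr _ _]]] := tree_two_leaves tT.
by have := sum_deg tT lr; rewrite card_ord; lia.
Qed.

Let hB := base_leq.
Let off_le k : k <= n -> offset L k <= B. Proof. exact: offset_homo. Qed.

Record frame st : Prop := Frame {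
  frame_in : forall a, a < B -> Defs.mem st a = nth 0 (encode L) a;
  frame0 : regs st 0 = B + 3 * n + 1;
  frame2 : regs st 2 = n;
  frame3 : regs st 3 = 1;
  frame4 : regs st 4 = 0;
  frame5 : regs st 5 = B;
  frame6 : regs st 6 = B + n;
  frame7 : regs st 7 = B + 2 * n }.

Lemma frame_ext st st' : frame st ->
  (forall a, a < B -> Defs.mem st' a = Defs.mem st a) ->
  (forall k, k \in [:: 0; 2; 3; 4; 5; 6; 7] -> regs st' k = regs st k) -> frame st'.
Proof.
case=> fi f0 f2 f3 f4 f5 f6 f7 Em Er.
by split; rewrite ?Er // => a aB; rewrite Em ?fi.
Qed.

Definition same_but (ks : seq nat) st st' : Prop :=
  Defs.mem st' = Defs.mem st /\ forall k, k \notin ks -> regs st' k = regs st k.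

Lemma frame_same ks st st' : frame st -> same_but ks st st' ->
  all [predC ks] [:: 0; 2; 3; 4; 5; 6; 7] -> frame st'.
Proof.
move=> fs [Em Er] /allP out; apply: frame_ext fs _ _ => [a _|k /out /= kk]; first by rewrite Em.
exact: Er.
Qed.

Lemma set_reg_other st k r x : k != r -> regs (set_reg st r x) k = regs st k.
Proof. by move=> kr; rewrite /= (negPf kr). Qed.

Lemma wp_setup Q :
  (forall st, frame st -> Defs.mem st = nth 0 (encode L) ->
     regs st 1 = 0 -> regs st 8 = 0 -> regs st 9 = 0 -> Q 8 st) ->
  wp W setup_cmd (input_state L) Q.
Proof.
move=> H; rewrite /setup_cmd.
apply: wp_seq; apply: wp_const; first lia.
apply: wp_seq; apply: (wp_read (v := n)) => /=; [by [] | lia | lia |].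
apply: wp_seq; apply: wp_add => /=; first lia.
apply: wp_seq; apply: (wp_read (v := B)) => /=; [by rewrite addn1 encode_offset | lia | lia |].
apply: wp_seq; apply: wp_add => /=; first lia.
apply: wp_seq; apply: wp_add => /=; first lia.
apply: wp_seq; apply: wp_add => /=; first lia.
apply: wp_add => /=; first lia.
apply: H => //; split=> //=; lia.
Qed.

Lemma wp_degree st v Q : frame st -> regs st 8 = v ->
  (forall st', same_but [:: 11; 12; 13; 14] st st' ->
     regs st' 12 = offset L v -> regs st' 13 = offset L v + size (L v) ->
     regs st' 14 = size (L v) -> Q 5 st') ->
  wp W degree_cmd st Q.
Proof.
case=> fi f0 f2 f3 f4 f5 f6 f7 f8 H; rewrite /degree_cmd.
have vn := ltn_ord v; have le1 := off_le (ltnW vn); have le2 := off_le vn.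
have lt : v.+2 < B by rewrite offset_max; lia.
have E := offsetS L v.
apply: wp_seq; apply: wp_add; rewrite ?f8 ?f3; first lia.
apply: wp_seq; apply: (wp_read (v := offset L v)) => /=; [ | lia | lia |].
  by rewrite addn1 fi ?encode_offset //; lia.
apply: wp_seq; apply: wp_add; rewrite /= ?f3; first lia.
apply: wp_seq; apply: (wp_read (v := offset L v.+1)) => /=; [ | lia | lia |].
  by rewrite !addn1 fi ?encode_offset //; lia.
apply: wp_sub => /=; first lia.
apply: H => /=; rewrite ?E ?addKn //; split=> // k.
by rewrite !inE !negb_or => /and4P[/negPf k1 /negPf k2 /negPf k3 /negPf k4] /=; rewrite k1 k2 k3 k4.
Qed.

Lemma size_list_leaf v : (size (L v) == 1) = leaf T v.
Proof. by rewrite size_list. Qed.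

Lemma size_list_gt0 v : 0 < size (L v).
Proof. by have [w vw] := tree_nbr tT (inT v); rewrite size_list (deg_gt0 vw). Qed.

Lemma wp_root st Q : frame st -> regs st 8 = 0 ->
  (forall t st' r, same_but [:: 8; 11; 12; 13; 14] st st' -> leaf T r -> regs st' 8 = r ->
     t <= 8 * n + 8 -> Q t st') ->
  wp W root_cmd st Q.
Proof.
move=> fs f8 H; rewrite /root_cmd; apply: wp_seq.
have n0 : 0 < n by lia.
apply: (wp_degree (v := Ordinal n0)) => // st1 sb1 _ _ e14.
have [x [_ [lx _ _]]] := tree_two_leaves tT.
(* The search cannot pass the leaf [x], which keeps the vertex number below [n]. A round takes 7
   steps including its test, within the 8 allotted. *)
pose I (v : 'I_n) st' := [/\ same_but [:: 8; 11; 12; 13; 14] st st', regs st' 8 = v,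
  regs st' 14 = size (L v) & v <= x].
apply: (wp_while (I := I) (phi := fun v : 'I_n => 8 * (n - v)) (x := Ordinal n0)).
- move=> v st2 [sb2 g8 g14 vx]; have fs2 := frame_same fs sb2 isT.
  rewrite g14 (frame3 fs2) => lt1.
  have {}vx : v < x.
    rewrite ltn_neqAle vx andbT; apply: contraTneq lt1 => E.
    have -> : v = x by apply: val_inj.
    by move: lx; rewrite -size_list_leaf => /eqP->.
  have xn := ltn_ord x; have vn : v.+1 < n by lia.
  apply: wp_seq; apply: wp_add; rewrite g8 (frame3 fs2); first lia.
  apply: (wp_degree (v := Ordinal vn)).
  + by apply: (frame_same (ks := [:: 8])) fs2 _ _ => //; split=> // k; rewrite inE => /set_reg_other ->.
  + by rewrite /= addn1.
  move=> st3 [Em Er] _ _ h14; exists (Ordinal vn); last by rewrite /=; lia.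
  split=> //; last by rewrite Er //= addn1.
  case: sb2 => Em2 Er2; split; first by rewrite Em.
  move=> k kk; rewrite Er; last by move: kk; rewrite !inE !negb_or => /and5P[_ -> -> -> ->].
  by rewrite set_reg_other ?Er2 //; move: kk; rewrite inE negb_or => /andP[].
- split=> //; case: sb1 => Em Er; last by rewrite Er.
  by split=> // k; rewrite in_cons negb_or => /andP[_ kk]; apply: Er.
move=> t v st2 [sb2 g8 g14 vx]; have fs2 := frame_same fs sb2 isT.
rewrite g14 (frame3 fs2) /= subn0 => le1 le.
apply: (H _ _ v) => //; last lia.
by rewrite -size_list_leaf eqn_leq le1 size_list_gt0.
Qed.

(** * Breadth-first search from a leaf and selection in reverse order *)

Section Search.
Variable r : 'I_n.
Hypothesis lr : leaf T r.
Implicit Types (h : nat).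

Definition parent_code v : nat := if v == r then n else val (parent T r v).

Lemma parent_code_leq v : parent_code v <= n.
Proof. by rewrite /parent_code; case: ifP => // _; apply: ltnW (ltn_ord _). Qed.

Lemma parent_code_child v w : adj T v w -> (val w != parent_code v) = child T r v w.
Proof.
move=> vw; rewrite (childE tT lr vw) /parent_code; case: (v =P r) => //= _.
by rewrite (ltn_eqF (ltn_ord w)).
Qed.

Lemma child_code v w : child T r v w -> parent_code w = v.
Proof. by rewrite /parent_code => /and3P[_ /negPf-> /eqP->]. Qed.

Record found q st : Prop := Found {
  found_queue : forall j, j < size q -> Defs.mem st (B + j) = nth r q j;
  found_parent : forall w, w \in q -> Defs.mem st (B + n + w) = parent_code w }.

Definition fresh st : Prop := forall a, B + 2 * n <= a -> Defs.mem st a = 0.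

Lemma wp_push st q v w Q : frame st -> found q st -> fresh st -> size q < n ->
  regs st 8 = v -> regs st 10 = size q -> regs st 15 = w -> parent_code w = v ->
  (forall st', frame st' -> found (rcons q w) st' -> fresh st' ->
     regs st' 10 = (size q).+1 ->
     (forall k, k \notin [:: 10; 11] -> regs st' k = regs st k) -> Q 5 st') ->
  wp W push_cmd st Q.
Proof.
move=> fs [fq fp] z qn f8 f10 f15 pw H; have vn := ltn_ord v; have wn := ltn_ord w.
rewrite /push_cmd.
apply: wp_seq; apply: wp_add; rewrite (frame5 fs) f10; first lia.
apply: wp_seq; apply: wp_write; rewrite /= ?f15; [lia | lia |].
apply: wp_seq; apply: wp_add; rewrite /= ?f10 ?(frame3 fs); first lia.
apply: wp_seq; apply: wp_add; rewrite /= ?f15 ?(frame6 fs); first lia.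
apply: wp_write; rewrite /= ?f8; [lia | lia |].
apply: H => /=; last 1 first.
- by move=> k; rewrite !inE !negb_or => /andP[/negPf k1 /negPf k2] /=; rewrite k1 k2.
- apply: frame_ext fs _ _ => [a aB|k] /=.
    by rewrite ifF ?ifF //; lia.
  by rewrite !inE => /or4P[/eqP->|/eqP->|/eqP->|/or4P[]/eqP->].
- split=> [j|x] /=.
    rewrite size_rcons nth_rcons => jq; rewrite ifF; last lia.
    rewrite eqn_add2l; case: (ltngtP j (size q)) => [jq'|jq'|//]; last lia.
    exact: fq.
  rewrite mem_rcons inE eqn_add2l => xq; case: (eqVneq (x : nat) w) => [xw|xw].
    by rewrite -pw; congr parent_code; apply/esym/val_inj.
  rewrite ifF; last by lia.
  by apply: fp; move: xq; rewrite -(inj_eq val_inj) (negPf xw).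
- move=> a aB /=; rewrite ifF ?ifF; first exact: z; lia.
- by rewrite addn1.
Qed.

Definition discovered v i : seq 'I_n := [seq w <- take i (L v) | val w != parent_code v].

Lemma discoveredS v i : i < size (L v) ->
  discovered v i.+1 = let w := nth v (L v) i in
    if val w != parent_code v then rcons (discovered v i) w else discovered v i.
Proof.
by move=> iL; rewrite /discovered (take_nth v) // filter_rcons.
Qed.

Lemma size_discovered v i : size (discovered v i) <= size (discovered v (size (L v))).
Proof.
rewrite /discovered take_size -{2}[L v](cat_take_drop i) filter_cat size_cat.
exact: leq_addr.
Qed.

Lemma discovered_children v w : (w \in discovered v (size (L v))) = child T r v w.
Proof.
rewrite /discovered take_size mem_filter; have [_ ->] := aL v.
apply/andP/idP => [[cw vw]|ch]; first by rewrite -parent_code_child.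
by have vw : adj T v w by [case/and3P: ch]; rewrite parent_code_child.
Qed.

(** At most one neighbor, the parent, is skipped. The cost of scanning a list can thus be charged to
    the vertices it discovers, plus a constant. *)
Lemma size_discovered_children v :
  size (L v) <= (size (discovered v (size (L v)))).+1.
Proof.
have [uL _] := aL v; rewrite /discovered take_size size_filter.
set a := fun w => _; rewrite -(count_predC a (L v)) -addn1 leq_add2l.
rewrite -size_filter; have := filter_uniq (predC a) uL.
case E: [seq w <- L v | predC a w] => [|x [|y t]] //= /andP[xy _].
have A z : z \in [seq w <- L v | predC a w] -> val z = parent_code v.
  by rewrite mem_filter /= negbK => /andP[/eqP].
case/negP: xy; rewrite (_ : x = y) ?mem_head //; apply: val_inj.
by rewrite !A ?E ?inE ?eqxx ?orbT.
Qed.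

Lemma wp_scan st q v Q : frame st -> found q st -> fresh st ->
  size q + size (discovered v (size (L v))) <= n ->
  regs st 8 = v -> regs st 10 = size q ->
  regs st 12 = offset L v -> regs st 13 = offset L v + size (L v) ->
  regs st 16 = parent_code v ->
  (forall t st', frame st' -> found (q ++ discovered v (size (L v))) st' -> fresh st' ->
     regs st' 10 = size (q ++ discovered v (size (L v))) ->
     (forall k, k \in [:: 1; 9] -> regs st' k = regs st k) ->
     t <= 12 * size (L v) + 1 -> Q t st') ->
  wp W (WhileLt 12 13 scan_cmd) st Q.
Proof.
move=> fs fq z qn f8 f10 f12 f13 f16 H; have pn := parent_code_leq v.
have le2 := off_le (ltn_ord v); have E2 := offsetS L v.
pose I i st' := [/\ frame st', found (q ++ discovered v i) st' & fresh st'] /\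
  [/\ i <= size (L v), regs st' 10 = size (q ++ discovered v i), regs st' 12 = offset L v + i &
    forall k, k \in [:: 1; 8; 9; 13; 16] -> regs st' k = regs st k].
(* A round that pushes a vertex takes 12 steps, counting the loop test; other rounds are shorter. *)
apply: (wp_while (I := I) (phi := fun i => 12 * (size (L v) - i)) (x := 0)); last 2 first.
- by split; split; rewrite /discovered ?take0 ?cats0 ?addn0.
- move=> t i st2 [[fs2 fq2 z2] [iL g10 g12 g]]; rewrite g12 g // f13 leq_add2l => Li le.
  have Ei : i = size (L v) by apply/eqP; rewrite eqn_leq iL.
  rewrite {}Ei in fq2 g10 le; apply: H => //; last by rewrite subnn in le; lia.
  by move=> k kk; apply: g; move: kk; rewrite !inE => /orP[]/eqP->.
move=> i st2 [[fs2 fq2 z2] [_ g10 g12 g]]; rewrite g12 g // f13 ltn_add2l => iL.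
set w := nth v (L v) i; have wn := ltn_ord w.
have wL : w \in L v by apply: mem_nth.
have vw : adj T v w by have [_ <-] := aL v.
have dS := discoveredS iL; rewrite /= -/w in dS.
have dle := size_discovered v i.+1.
rewrite /scan_cmd.
apply: wp_seq; apply: (wp_read (v := w)); rewrite ?g12; [ | lia | lia |].
  by rewrite (frame_in fs2) ?encode_list //; lia.
apply: wp_seq; apply: wp_sub; rewrite /= ?g // ?f16; first lia.
apply: wp_seq; apply: wp_sub; rewrite /= ?g // ?f16; first lia.
apply: wp_seq; apply: wp_add => /=; first lia.
set st3 := set_reg _ 11 _.
have fs3 : frame st3.
  apply: frame_ext fs2 _ _ => // k.
  by rewrite !inE => /or4P[/eqP->|/eqP->|/eqP->|/or4P[]/eqP->].
have g3 k : k \in [:: 1; 8; 9; 13; 16] -> regs st3 k = regs st k.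
  by move=> kk; rewrite -g //; move: kk; rewrite !inE => /or4P[/eqP->|/eqP->|/eqP->|/orP[]/eqP->].
have g310 : regs st3 10 = size (q ++ discovered v i) by [].
have g312 : regs st3 12 = offset L v + i by [].
have g315 : regs st3 15 = w by [].
have fq3 : found (q ++ discovered v i) st3 by case: fq2.
have z3 : fresh st3 by [].
have g311 : (0 < regs st3 11) = (val w != parent_code v) by rewrite /=; lia.
clearbody st3.
apply: wp_seq; apply: wp_if; rewrite (frame4 fs3) => cmp.
  have cw : val w != parent_code v by rewrite -g311.
  rewrite cw in dS.
  apply: (wp_push (v := v) (w := w) fs3 fq3 z3) => //.
  - by rewrite size_cat; move: dle; rewrite dS size_rcons; lia.
  - by rewrite g3.
  - by apply: child_code; rewrite -parent_code_child.
  move=> st4 fs4 fq4 z4 g410 g4.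
  have g4' k : k \in [:: 1; 8; 9; 12; 13; 16] -> regs st4 k = regs st3 k.
    by move=> kk; apply: g4; move: kk; rewrite !inE => /or4P[/eqP->|/eqP->|/eqP->|/or3P[]/eqP->].
  apply: wp_add; rewrite g4' // (frame3 fs4) g312; first lia.
  exists i.+1; last lia; rewrite /I dS -rcons_cat; split; split=> //.
  - apply: frame_ext fs4 _ _ => // k.
    by rewrite !inE => /or4P[/eqP->|/eqP->|/eqP->|/or4P[]/eqP->].
  - by case: fq4.
  - by rewrite /= size_rcons.
  - by rewrite /=; lia.
  move=> k kk; rewrite -g3 //; move: kk.
  by rewrite !inE => /or4P[/eqP->|/eqP->|/eqP->|/orP[]/eqP->] /=; rewrite g4'.
have cw : val w = parent_code v by apply/eqP; move: cmp; rewrite leqNgt g311 negbK.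
rewrite cw eqxx /= in dS.
apply: wp_const; first lia.
apply: wp_add; rewrite /= g312 (frame3 fs3); first lia.
exists i.+1; last lia; rewrite /I dS; split; split=> //.
- apply: frame_ext fs3 _ _ => // k.
  by rewrite !inE => /or4P[/eqP->|/eqP->|/eqP->|/or4P[]/eqP->].
- by case: fq3.
- by rewrite /=; lia.
move=> k kk; rewrite -g3 //; move: kk.
by rewrite !inE => /or4P[/eqP->|/eqP->|/eqP->|/orP[]/eqP->].
Qed.

Lemma wp_fetch st h v Q : frame st -> regs st 9 = h -> h < n ->
  Defs.mem st (B + h) = v ->
  (forall st', same_but [:: 8; 11; 12; 13; 14] st st' -> regs st' 8 = v ->
     regs st' 12 = offset L v -> regs st' 13 = offset L v + size (L v) ->
     regs st' 14 = size (L v) -> Q 7 st') ->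
  wp W fetch_cmd st Q.
Proof.
move=> fs f9 hn fv H; have vn := ltn_ord v; rewrite /fetch_cmd.
apply: wp_seq; apply: wp_add; rewrite (frame5 fs) f9; first lia.
apply: wp_seq; apply: (wp_read (v := v)) => //=; [lia | lia |].
apply: (wp_degree (v := v)) => //.
  apply: frame_ext fs _ _ => // k.
  by rewrite !inE => /or4P[/eqP->|/eqP->|/eqP->|/or4P[]/eqP->].
move=> st' [Em Er] g12 g13 g14; apply: H => //; last by rewrite Er.
split=> [|k]; first by rewrite Em.
rewrite in_cons negb_or => /andP[k8 kk]; rewrite Er // !set_reg_other //.
by move: kk; rewrite in_cons negb_or => /andP[].
Qed.

Lemma wp_search st Q : frame st -> Defs.mem st = nth 0 (encode L) ->
  regs st 8 = r -> regs st 1 = 0 -> regs st 9 = 0 ->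
  (forall t st' q, frame st' -> bfs T r (size q) q -> found q st' -> fresh st' ->
     regs st' 1 = 0 -> regs st' 9 = size q -> t <= 42 * n + 5 -> Q t st') ->
  wp W search_cmd st Q.
Proof.
move=> fs Em f8 f1 f9 H; have rn := ltn_ord r; rewrite /search_cmd.
apply: wp_seq; apply: wp_write; rewrite ?(frame5 fs) ?f8; [lia | lia |].
apply: wp_seq; apply: wp_add; rewrite /= ?(frame6 fs) ?f8; first lia.
apply: wp_seq; apply: wp_write; rewrite /= ?(frame2 fs); [lia | lia |].
apply: wp_seq; apply: wp_const; first lia.
set st1 := set_reg _ 10 _.
have fs1 : frame st1.
  apply: frame_ext fs _ _ => [a aB|k] /=; first by rewrite ifF ?ifF //; lia.
  by rewrite !inE => /or4P[/eqP->|/eqP->|/eqP->|/or4P[]/eqP->].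
have fq1 : found [:: r] st1.
  split=> [j|w] /=; first by rewrite ltnS leqn0 => /eqP->; rewrite addn0 eqxx ifF //; lia.
  by rewrite inE => /eqP->; rewrite eqxx /parent_code eqxx.
have z1 : fresh st1.
  by move=> a aB /=; rewrite ifF ?ifF ?Em ?encode_default //; lia.
pose I (x : nat * seq 'I_n) st' := [/\ frame st', found x.2 st' & fresh st'] /\
  [/\ bfs T r x.1 x.2, regs st' 9 = x.1, regs st' 10 = size x.2 & regs st' 1 = 0].
have size_bfs h q : bfs T r h q -> size q <= n.
  move=> bq; have := max_card [in q]; rewrite card_ord.
  by rewrite (card_uniqP (bfs_uniq bq)).
(* Expanding [v] costs at most [12 + 12 * size (L v)] steps, hence at most 24 plus 12 for each
   discovered vertex; 30 leaves some slack. *)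
apply: (wp_while (I := I) (phi := fun x => 12 * (n - size x.2) + 30 * (n - x.1)) (x := (0, [:: r]))); last 2 first.
- by split; split=> //; exact: bfs_init.
- move=> t [h q] st2 /= [[fs2 fq2 z2] [bq g9 g10 g1]]; rewrite g9 g10 => qh le.
  have Eh : h = size q by apply/eqP; rewrite eqn_leq qh (bfs_size bq).
  by rewrite Eh in bq g9; apply: (H _ _ q) => //; lia.
move=> [h q] st2 /= [[fs2 fq2 z2] [bq g9 g10 g1]]; rewrite g9 g10 => hq.
have qn := size_bfs _ _ bq; have hn : h < n := leq_trans hq qn.
set v := nth r q h; have vq : v \in q by apply: mem_nth.
have vn := ltn_ord v; have pn := parent_code_leq v.
have bq' : bfs T r h.+1 (q ++ discovered v (size (L v))).
  apply: (bfs_step lr bq hq); last exact: discovered_children.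
  by have [uL _] := aL v; apply: filter_uniq; apply: take_uniq.
have qn' := size_bfs _ _ bq'; rewrite size_cat in qn'.
apply: wp_seq; apply: (wp_fetch (v := v) fs2 g9 hn); first exact: (found_queue fq2).
move=> st3 sb3 g38 g312 g313 _.
have fs3 : frame st3 by apply: frame_same sb3 _.
have [Em3 Er3] := sb3.
apply: wp_seq; apply: wp_add; rewrite (frame6 fs3) g38; first lia.
apply: wp_seq; apply: (wp_read (v := parent_code v)) => /=; [|lia|lia|].
  by rewrite Em3 (found_parent fq2).
set st4 := set_reg _ 16 _.
have fs4 : frame st4.
  apply: frame_ext fs3 _ _ => // k.
  by rewrite !inE => /or4P[/eqP->|/eqP->|/eqP->|/or4P[]/eqP->].
apply: wp_seq; apply: (wp_scan (v := v) (q := q) fs4) => //.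
- by case: fq2 => fq fp; split=> *; rewrite /= Em3; [apply: fq | apply: fp].
- by move=> a aB; rewrite /= Em3 z2.
- by rewrite /= Er3.
move=> t st5 fs5 fq5 z5 g510 g5 le5.
apply: wp_add; rewrite g5 //= Er3 // g9 (frame3 fs5); first lia.
exists (h.+1, q ++ discovered v (size (L v))).
  split; split=> //=.
  - apply: frame_ext fs5 _ _ => // k.
    by rewrite !inE => /or4P[/eqP->|/eqP->|/eqP->|/or4P[]/eqP->].
  - by case: fq5.
  - by rewrite addn1.
  by rewrite g5 //= Er3.
by have := size_discovered_children v; rewrite /= size_cat; lia.
Qed.

Definition outputs s st : Prop :=
  forall j, j < size s -> Defs.mem st (B + 3 * n + 1 + j) = nth r s j.

(** The cell that follows the counters is that of the fictitious parent of [r]. *)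
Definition counts (D A : {set 'I_n}) st : Prop :=
  (forall u, u \notin D -> Defs.mem st (B + 2 * n + u) = pending T r D A u) /\
  (r \notin D -> Defs.mem st (B + 3 * n) = 0).

Lemma found_ext q st st' : found q st ->
  (forall a, B <= a -> a < B + 2 * n -> Defs.mem st' a = Defs.mem st a) ->
  size q <= n -> found q st'.
Proof.
case=> fq fp Em qn; split=> [j jq|w wq]; rewrite Em ?fq ?fp //; try lia.
by have := ltn_ord w; lia.
Qed.

Lemma wp_choose st s v Q : frame st -> outputs s st -> size s < n ->
  regs st 1 = size s -> regs st 8 = v ->
  (forall st', frame st' -> outputs (rcons s v) st' -> regs st' 1 = (size s).+1 ->
     regs st' 9 = regs st 9 ->
     (forall a, a < B + 3 * n + 1 -> Defs.mem st' a = Defs.mem st a) -> Q 3 st') ->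
  wp W choose_cmd st Q.
Proof.
move=> fs os sn f1 f8 H; have vn := ltn_ord v; rewrite /choose_cmd.
apply: wp_seq; apply: wp_add; rewrite (frame0 fs) f1; first lia.
apply: wp_seq; apply: wp_write; rewrite /= ?f8; [lia | lia |].
apply: wp_add; rewrite /= f1 (frame3 fs); first lia.
apply: H => //=.
- apply: frame_ext fs _ _ => [a aB|k] /=; first by rewrite ifF //; lia.
  by rewrite !inE => /or4P[/eqP->|/eqP->|/eqP->|/or4P[]/eqP->].
- move=> j; rewrite size_rcons nth_rcons /= eqn_add2l => js.
  by case: (ltngtP j (size s)) => [js'|js'|//]; [exact: os | lia].
- by rewrite addn1.
by move=> a aB; rewrite ifF //; lia.
Qed.

Lemma wp_notify st v c Q : frame st -> regs st 8 = v ->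
  Defs.mem st (B + n + v) = parent_code v ->
  Defs.mem st (B + 2 * n + parent_code v) = c -> c <= n ->
  (forall st', frame st' -> regs st' 1 = regs st 1 -> regs st' 9 = regs st 9 ->
     (forall a, Defs.mem st' a =
        if a == B + 2 * n + parent_code v then c.+1 else Defs.mem st a) -> Q 6 st') ->
  wp W notify_cmd st Q.
Proof.
move=> fs f8 fp fc cn H; have vn := ltn_ord v; have pn := parent_code_leq v.
rewrite /notify_cmd.
apply: wp_seq; apply: wp_add; rewrite (frame6 fs) f8; first lia.
apply: wp_seq; apply: (wp_read (v := parent_code v)) => //=; [lia | lia |].
apply: wp_seq; apply: wp_add; rewrite /= (frame7 fs); first lia.
apply: wp_seq; apply: (wp_read (v := c)) => //=; [lia | lia |].
apply: wp_seq; apply: wp_add; rewrite /= (frame3 fs); first lia.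
apply: wp_write => /=; [lia | lia |].
apply: H => //=; last by move=> a; rewrite addn1.
apply: frame_ext fs _ _ => [a aB|k] /=; first by rewrite ifF //; lia.
by rewrite !inE => /or4P[/eqP->|/eqP->|/eqP->|/or4P[]/eqP->].
Qed.

Lemma wp_select st q Q : frame st -> bfs T r (size q) q -> found q st -> fresh st ->
  regs st 1 = 0 -> regs st 9 = size q ->
  (forall t st' s, alg_run T s && alg_halted T s -> regs st' 0 = B + 3 * n + 1 ->
     regs st' 1 = size s -> outputs s st' -> t <= 30 * n + 1 -> Q t st') ->
  wp W select_cmd st Q.
Proof.
move=> fs bq fq z f1 f9 H; have qT := bfs_final tT lr bq; have uq := bfs_uniq bq.
have mq v : v \in q by rewrite qT.
have sq : size q = n.
  by rewrite -(card_uniqP uq) -[RHS]card_ord; apply: eq_card => v; rewrite mq.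
(* [i] vertices remain to be treated. The treated ones are the end of the queue, where [bfs_order]
   has put children behind their parents. *)
pose D i := [set v in drop i q].
pose I (x : nat * {set 'I_n} * seq 'I_n) st' := let: (i, A, s) := x in
  [/\ frame st', found q st', outputs s st' & counts (D i) A st'] /\
  [/\ rinv T r (D i) A s, i <= n, regs st' 9 = i & regs st' 1 = size s].
(* The longest round, one that notifies the parent, takes at most 21 steps with its test. *)
apply: (wp_while (I := I) (phi := fun x => 30 * x.1.1) (x := (n, [set x | leaf T x], [::]))); last 2 first.
- have D0 : D n = set0 by apply/setP => v; rewrite inE drop_oversize ?sq // inE.
  rewrite /I D0; split; split=> //; [ | exact: rinv_init | by rewrite f9].
  split=> [u _|_]; rewrite z; try lia.
  by apply/esym/eqP; rewrite cards_eq0; apply/eqP/setP => c; rewrite !inE.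
- move=> t [[i A] s] st2 [[fs2 fq2 os cs] [inv iN g9 g1]]; rewrite g9 (frame4 fs2) leqn0 => /eqP i0 le.
  have DT : D i = verts T by apply/setP => v; rewrite inE i0 drop0 mq inT.
  rewrite DT in inv; apply: (H _ _ s) => //; last by rewrite /= in le; lia.
    by rewrite (rinv_final tT lr inv).
  exact: (frame0 fs2).
move=> [[i0 A] s] st2 [[fs2 fq2 os cs] [inv iN g9 g1]]; rewrite g9 (frame4 fs2).
case: i0 => // i in iN inv cs g9 *; move=> _.
have iq : i < size q by rewrite sq.
set v := nth r q i; have vn := ltn_ord v.
have ED : D i = v |: D i.+1.
  by apply/setP => w; rewrite !inE (drop_nth r iq) inE.
have uq' : uniq (v :: drop i.+1 q) by rewrite -drop_nth // drop_uniq.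
have vD : v \notin D i.+1 by rewrite inE; case/andP: uq'.
have chD c : child T r v c -> c \in D i.+1.
  move=> ch; have := bfs_order bq ch (mq v) (mq c).
  rewrite inE /v index_uniq // => lt.
  have := mq c; rewrite -{1}(cat_take_drop i.+1 q) mem_cat in_take ?mq //.
  by rewrite ltnNge lt.
have card_v := card_subtree tT lr inv (inT v) vD chD.
have pend_step u := pending_step tT lr inv (inT v) vD chD (u := u).
have inv' := rinv_step tT lr inv (inT v) vD chD; rewrite -ED in inv'.
have pn := parent_code_leq v.
rewrite -ED in pend_step.
(* The output stays within the word bound because a run of the algorithm makes at most [n]
   choices. *)
have sn : forall A' s', rinv T r (D i) A' s' -> size s' <= n.
  move=> A' s' inv2; have [_ le _] := alg_run_spec tT (rinv_run inv2).
  by rewrite VT cardsT card_ord in le.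
apply: wp_seq; apply: wp_sub; rewrite g9 (frame3 fs2); first lia.
rewrite subn1 /=; set st3 := set_reg _ 9 _.
have fs3 : frame st3.
  apply: frame_ext fs2 _ _ => // k.
  by rewrite !inE => /or4P[/eqP->|/eqP->|/eqP->|/or4P[]/eqP->].
apply: wp_seq; apply: (wp_fetch (v := v) (h := i) fs3) => //; first exact: (found_queue fq2).
move=> st4 sb4 g48 _ _ g414; have fs4 := frame_same fs3 sb4 isT.
have [Em4 Er4] := sb4.
have g41 : regs st4 1 = size s by rewrite Er4.
have g49 : regs st4 9 = i by rewrite Er4.
have cv : Defs.mem st4 (B + 2 * n + v) = pending T r (D i.+1) A v by rewrite Em4 (cs.1).
have pv := pending_leq T r (D i.+1) A v; rewrite card_ord in pv.
apply: wp_seq; apply: wp_add; rewrite (frame7 fs4) g48; first lia.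
apply: wp_seq; apply: (wp_read (v := pending T r (D i.+1) A v)) => //=; [lia | lia |].
set k := #|A :&: subtree T r v| in card_v pend_step *.
apply: wp_seq; apply: (wp_mono (Q := fun t st' => t <= 2 /\
    [/\ Defs.mem st' = Defs.mem st4, forall k, k \notin [:: 11; 15] -> regs st' k = regs st4 k &
        regs st' 15 = k])).
  have L0 := size_list_gt0 v; have Ll := size_list_leaf v.
  apply: wp_if; rewrite /= (frame3 fs4) g414 => cmp.
    have nl : leaf T v = false by rewrite -Ll gtn_eqF.
    apply: wp_const; first lia.
    split=> //; split=> // [j|] /=; last by rewrite card_v nl.
    by rewrite !inE negb_or => /andP[/negPf j1 /negPf j2] /=; rewrite ?j1 ?j2.
  have l1 : leaf T v by rewrite -Ll eqn_leq cmp.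
  apply: wp_add; rewrite /= (frame3 fs4); first lia.
  split=> //; split=> // [j|] /=; last by rewrite card_v l1 addnC.
  by rewrite !inE negb_or => /andP[/negPf j1 /negPf j2] /=; rewrite ?j1 ?j2.
move=> t5 st5 [le5 [Em5 Er5 g515]].
have fs5 : frame st5.
  apply: frame_ext fs4 _ _ => [a _|j]; first by rewrite Em5.
  by rewrite !inE => /or4P[/eqP->|/eqP->|/eqP->|/or4P[]/eqP->]; rewrite Er5.
have Em : Defs.mem st5 = Defs.mem st2 by rewrite Em5 Em4.
have os5 : outputs s st5 by move=> j js; rewrite Em os.
have fq5 : found q st5 by case: fq2 => fq2 fp2; split=> *; rewrite Em; [apply: fq2 | apply: fp2].
have g51 : regs st5 1 = size s by rewrite Er5.
have g59 : regs st5 9 = i by rewrite Er5.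
have g58 : regs st5 8 = v by rewrite Er5.
apply: wp_if; rewrite (frame3 fs5) g515 => cmp.
  have Er : rstep T r (A, s) v = (A :\: subtree T r v, rcons s v) by rewrite /rstep cmp.
  rewrite Er /= in inv'; have ss := sn _ _ inv'; rewrite size_rcons in ss.
  apply: (wp_choose fs5 os5 ss g51 g58) => st6 fs6 os6 g61 g69 Em6.
  exists (i, A :\: subtree T r v, rcons s v); last by rewrite /=; lia.
  split; split=> //; [ | | lia | by rewrite g69 | by rewrite size_rcons].
    by apply: (found_ext fq5); [move=> a _ aB; apply: Em6; lia | rewrite sq].
  split=> [u uD|rD].
    have un := ltn_ord u; rewrite Em6; last lia.
    have := pend_step u uD; rewrite Er /= => ->.
    rewrite Em cs.1; last by apply: contra uD; rewrite ED in_setU1 => ->; rewrite orbT.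
    by rewrite (gtn_eqF cmp) andbF addn0.
  rewrite Em6; last lia; rewrite Em cs.2 //.
  by apply: contra rD; rewrite ED in_setU1 => ->; rewrite orbT.
have Er : rstep T r (A, s) v = (A, s) by rewrite /rstep /= ltnNge cmp.
rewrite Er /= in inv'.
have pend' u : u \notin D i -> pending T r (D i) A u = pending T r (D i.+1) A u + (child T r u v && (k == 1)).
  by move/pend_step; rewrite Er.
have sub u : u \notin D i -> u \notin D i.+1.
  by apply: contra; rewrite ED in_setU1 => ->; rewrite orbT.
apply: wp_if; rewrite (frame4 fs5) g515 => cmp0; last first.
  have k0 : k = 0 by lia.
  apply: wp_const; first lia.
  exists (i, A, s); last by rewrite /=; lia.
  split; split=> //; last lia.
  - apply: frame_ext fs5 _ _ => // j.
    by rewrite !inE => /or4P[/eqP->|/eqP->|/eqP->|/or4P[]/eqP->].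
  - by case: fq5.
  split=> [u uD|rD] /=; rewrite Em; last by rewrite cs.2 ?sub.
  by rewrite cs.1 ?sub // pend' // k0 andbF addn0.
have k1 : k = 1 by lia.
(* At the root the cell read belongs to the fictitious parent [n] and still holds 0. *)
pose c := if v == r then 0 else pending T r (D i.+1) A (parent T r v).
have pcD : v != r -> parent T r v \notin D i.
  move=> vr; have pc := parent_child tT lr (inT v) vr.
  rewrite ED in_setU1 negb_or; apply/andP; split.
    by case/and3P: pc => pv' _ _; apply: (adj_neq pv').
  by apply: contra vD => pD; apply: (rinv_closed inv).2 pD pc.
have cE : Defs.mem st5 (B + 2 * n + parent_code v) = c.
  rewrite /c /parent_code Em; case: eqP => [E|/eqP vr].
    rewrite (_ : B + 2 * n + n = B + 3 * n); last by lia.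
    by apply: cs.2; rewrite -E.
  by rewrite cs.1 // sub // pcD.
have cn : c <= n.
  by rewrite /c; case: ifP => // _; have := pending_leq T r (D i.+1) A (parent T r v); rewrite card_ord.
apply: (wp_notify fs5 g58 _ cE cn); first by rewrite (found_parent fq5).
move=> st6 fs6 g61 g69 Em6.
exists (i, A, s); last by rewrite /=; lia.
split; split=> //; [ | | | lia | by rewrite g69 | by rewrite g61].
- by apply: (found_ext fq5); [move=> a _ aB; rewrite Em6 ifF //; lia | rewrite sq].
- by move=> j js; rewrite Em6 ifF ?os5 //; lia.
split=> [u uD|rD]; last first.
  rewrite Em6 ifF ?Em ?cs.2 ?sub //.
  have vr : v != r by apply: contraNneq rD => <-; rewrite ED setU11.
  by have := ltn_ord (parent T r v); rewrite /parent_code (negPf vr) /=; lia.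
rewrite Em6 eqn_add2l pend' // k1 eqxx andbT; have un := ltn_ord u.
rewrite /c /parent_code; have [vr|vr] := eqVneq v r.
  rewrite ifF; last lia; rewrite Em cs.1 ?sub // /child vr eqxx andbF.
  by rewrite addn0.
case: (eqVneq (u : nat) (val (parent T r v))) => [/val_inj->|up].
  by rewrite (parent_child tT lr (inT v) vr) addn1.
rewrite Em cs.1 ?sub //; case: (boolP (child T r u v)) => [/child_parent E|]; last by rewrite addn0.
by case/eqP: up; rewrite E.
Qed.

End Search.
End Program.

(** The four phases add up to at most [80 * n + 22] steps, and the addresses used stay below
    [B + 4 * n + 1], at most [7 * n + 3]; the single generous bound [200 * n] covers both time and
    word size. *)
Lemma wp_gt n (T : graph 'I_n) (L : 'I_n -> seq 'I_n) :
  tree T -> verts T = [set: 'I_n] -> 1 < n -> adj_lists T L ->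
  wp (200 * n) gt_cmd (input_state L) (fun t st => t <= 200 * n /\
    exists2 s : seq 'I_n, alg_run T s && alg_halted T s & output st = [seq val i | i <- s]).
Proof.
move=> tT VT n1 aL; have hW := leqnn (200 * n); rewrite /gt_cmd.
apply: wp_seq; apply: (wp_setup tT n1 aL hW) => st1 fs1 Em1 f11 f18 f19.
apply: wp_seq; apply: (wp_root tT VT n1 aL hW fs1 f18) => t2 st2 r sb2 lr f28 le2.
have fs2 := frame_same fs1 sb2 isT; have [Em2 Er2] := sb2.
apply: wp_seq; apply: (wp_search tT n1 aL hW lr fs2) => //.
- by rewrite Em2.
- by rewrite Er2.
- by rewrite Er2.
move=> t3 st3 q fs3 bq fq z f31 f39 le3.
apply: (wp_select tT VT n1 aL hW lr fs3 bq fq z f31 f39).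
move=> t4 st4 s rs f40 f41 os le4; split; first by lia.
exists s => //; apply: (@eq_from_nth _ 0); rewrite /output !size_map size_iota //.
move=> j; rewrite f41 => js; rewrite (nth_map 0) ?size_iota // nth_iota // (nth_map r) //.
by rewrite f40 add0n os.
Qed.

(** First part: for every way of making the arbitrary choices, the algorithm
    stops, does not get stuck before, and returns a gt-set. Second part: it has
    an implementation on a random access machine with words of
    [log n + O(1)] bits that takes a number of steps linear in the order [n] of
    the tree, and outputs the vertices put into [S] in the order in which a
    complete run of the algorithm chooses them. *)
Theorem theorem4p4 :
  (forall (V : finType) (T : graph V), is_tree T -> 1 < #|verts T| ->
     [/\ forall s : seq V, alg_run T s -> size s <= #|verts T|,
         forall s : seq V, alg_run T s -> ~~ alg_halted T s ->
           exists p : V, alg_run T (rcons s p) &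
         forall s : seq V, alg_run T s -> alg_halted T s ->
           gt_set T (alg_state T s).1])
  /\
  (exists (prog : cmd) (c : nat),
     forall (n : nat) (T : graph 'I_n) (L : 'I_n -> seq 'I_n),
       is_tree T -> verts T = [set: 'I_n] -> 1 < n -> adj_lists T L ->
       exists (t : nat) (st : state) (s : seq 'I_n),
         [/\ exec (c * n) prog (input_state L) t st,
             t <= c * n,
             alg_run T s && alg_halted T s,
             output st = [seq val i | i <- s] &
             gt_set T (alg_state T s).1]).
Proof.
split=> [V T /is_treeP H /H tT|].
  split=> s rs; [by case: (alg_run_spec tT rs) | exact: alg_run_progress |].
  by case: (alg_run_spec tT rs).
exists gt_cmd, 200 => n T L itT VT n1 aL.
have tT : tree T by apply: is_treeP; rewrite // VT cardsT card_ord.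
have [t [st [ex [le [s rs os]]]]] := wp_gt tT VT n1 aL.
exists t, st, s; split=> //; case/andP: rs => rs hs.
by case: (alg_run_spec tT rs) => _ _; apply.
Qed.
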